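(* Let $(\mathcal{G},\mu,\gamma,\phi)$ be a finite-dimensional Lie quasi-bialgebra over $K$, and let $L=\partial_\mu d_\gamma+d_\gamma\partial_\mu:\Lambda^k\mathcal{G}\to\Lambda^k\mathcal{G}$ be its Laplacian. Then: (1) $L$ is a derivation of degree $0$ of $(\Lambda\mathcal{G},\wedge)$, and its transpose $L^*=d_\mu\partial_\gamma+\partial_\gamma d_\mu$ is a derivation of degree $0$ of $(\Lambda\mathcal{G}^*,\wedge)$; (2) the operators $L$ and $\partial_\mu$ commute, $[L,\partial_\mu]=0$; equivalently, $d_\mu$ and $L^*$ commute, $[L^*,d_\mu]=0$.
   Context: $K=\mathbb{R}$ or $\mathbb{C}$; $\mathcal{G}$ is a finite-dimensional $K$-vector space with dual $\mathcal{G}^*$. The pairing between $\Lambda\mathcal{G}^*$ and $\Lambda\mathcal{G}$ is $\langle \xi_1\wedge\dots\wedge\xi_m,x_1\wedge\dots\wedge x_n\rangle=\delta_{mn}\det(\langle\xi_i,x_j\rangle)$. A Lie quasi-bialgebra is $(\mathcal{G},\mu,\gamma,\phi)$ with $\mu\in \mathrm{Hom}(\Lambda^2\mathcal{G},\mathcal{G})$, $\gamma\in \mathrm{Hom}(\mathcal{G},\Lambda^2\mathcal{G})$, $\phi\in\Lambda^3\mathcal{G}$ such that: (a) $(\mathcal{G},\mu)$ is a Lie algebra; (b) $\gamma$ is a 1-cocycle of $(\mathcal{G},\mu)$ with values in $\Lambda^2\mathcal{G}$ for the adjoint action, i.e. $\gamma(\mu(x,y))=x\cdot\gamma(y)-y\cdot\gamma(x)$;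 (c) $\frac12 Alt\big((\gamma\otimes1)\gamma(x)\big)=-x\cdot\phi$ for all $x\in\mathcal{G}$, where $x\cdot\phi$ is the adjoint action of $x$ on $\phi$; (d) $Alt\big((\gamma\otimes1\otimes1)(\phi)\big)=0$. Here $Alt(x_1\otimes\dots\otimes x_n)=\sum_\sigma \mathrm{sign}(\sigma)x_{\sigma(1)}\otimes\dots\otimes x_{\sigma(n)}$, and $\Lambda\mathcal{G}$ is viewed inside the tensor algebra by $x_1\wedge\dots\wedge x_n=Alt(x_1\otimes\dots\otimes x_n)$. The letter $\gamma$ also denotes the skew bracket on $\mathcal{G}^*$ given by $\langle\gamma(x),\xi\wedge\eta\rangle=-\langle x,\gamma(\xi,\eta)\rangle$. The operator $\partial_\mu:\Lambda^{k}\mathcal{G}\to\Lambda^{k-1}\mathcal{G}$ is $\partial_\mu(x_1\wedge\dots\wedge x_k)=\sum_{i<j}(-1)^{i+j}\mu(x_i,x_j)\wedge x_1\wedge\dots\wedge\hat{x_i}\wedge\dots\wedge\hat{x_j}\wedge\dots\wedge x_k$, and $d_\mu:\Lambda^k\mathcal{G}^*\to\Lambda^{k+1}\mathcal{G}^*$ is its transpose, $\langle d_\mu A,X\rangle=\langle A,\partial_\mu X\rangle$. Likewise $\partial_\gamma:\Lambda^{k}\mathcal{G}^*\to\Lambda^{k-1}\mathcal{G}^*$ is given by the same formula with $\gamma(\xi_i,\xi_j)$ in place of $\mu(x_i,x_j)$, and $d_\gamma:\Lambda^k\mathcal{G}\to\Lambda^{k+1}\mathcal{G}$ is its transpose. 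*)

(* Defs.v *)
From HB Require Import structures.
From mathcomp Require Import all_boot all_order all_fingroup all_algebra.
From mathcomp Require Import reals complex zify.

Set Implicit Arguments.
Unset Strict Implicit.
Unset Printing Implicit Defensive.

Import Order.TTheory GRing.Theory Num.Theory.
Local Open Scope ring_scope.

Variant scalar_kind := RealScalars | ComplexScalars.

Definition scalars (R : realType) (b : scalar_kind) : numFieldType :=
  match b with
  | RealScalars => R : numFieldType
  | ComplexScalars => R[i] : numFieldType
  end.

Lemma linear_sumZ (K : pzRingType) (U W : lmodType K) (g : U -> W) : linear g ->
  forall (I : finType) (a : I -> K) (u : I -> U),
  g (\sum_i a i *: u i) = \sum_i a i *: g (u i).
Proof.
move=> lg I a u; pose gM := GRing.isLinear.Build K U W _ g lg.
pose gL : {linear U -> W} := HB.pack g gM.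
rewrite -[g _]/(gL _) raddf_sum; apply: eq_bigr => i _; exact: (linearZ_LR gL).
Qed.

Section Multilinear.
Variables (K : numFieldType) (V : vectType K).

Definition upd k (x : {ffun 'I_k -> V}) (i : 'I_k) (u : V) : {ffun 'I_k -> V} :=
  [ffun j => if j == i then u else x j].

Definition multilinear (W : lmodType K) k (F : {ffun 'I_k -> V} -> W) : Prop :=
  forall (x : {ffun 'I_k -> V}) (i : 'I_k), linear (fun u => F (upd x i u)).

(* Vanishing when two consecutive arguments coincide *)
Definition alternating (W : lmodType K) k (F : {ffun 'I_k -> V} -> W) : Prop :=
  forall (x : {ffun 'I_k -> V}) (i j : 'I_k),
    j = i.+1 :> nat -> x i = x j -> F x = 0.

Lemma upd_id k (x : {ffun 'I_k -> V}) i : upd x i (x i) = x.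
Proof. by apply/ffunP => j; rewrite ffunE; case: eqP => [->|]. Qed.

Lemma multilinear_sum (W : lmodType K) k (F : {ffun 'I_k -> V} -> W) :
  multilinear F -> forall n (a : 'I_k -> 'I_n -> K) (u : 'I_n -> V),
  F [ffun i => \sum_j a i j *: u j] =
  \sum_(f : {ffun 'I_k -> 'I_n}) (\prod_i a i (f i)) *: F [ffun i => u (f i)].
Proof.
elim: k F => [|k IH] F mF n a u.
  pose f0 : {ffun 'I_0 -> 'I_n} := [ffun i : 'I_0 => match (notF (ltn_ord i)) with end].
  have all0 (f : {ffun 'I_0 -> 'I_n}) : f = f0 by apply/ffunP => -[].
  rewrite (bigD1 f0) //= big_ord0 scale1r big1 ?addr0; last first.
    by move=> f; rewrite (all0 f) eqxx.
  by congr F; apply/ffunP => -[].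
pose fc (T : Type) (t : T) (y : {ffun 'I_k -> T}) : {ffun 'I_k.+1 -> T} :=
  [ffun i => oapp y t (unlift ord0 i)].
have fc0 (T : Type) (t : T) y : fc T t y ord0 = t by rewrite ffunE unlift_none.
have fcS (T : Type) (t : T) y i : fc T t y (lift ord0 i) = y i.
  by rewrite ffunE liftK.
have fcE (T : Type) (z : {ffun 'I_k.+1 -> T}) :
    z = fc T (z ord0) [ffun i => z (lift ord0 i)].
  apply/ffunP => i; rewrite ffunE; case: (unliftP ord0 i) => [j ->|->] //=.
  by rewrite ffunE.
have mFt t : multilinear (fun y => F (fc V t y)).
  move=> y i c v w; have := mF (fc V t y) (lift ord0 i) c v w.
  suff E z : upd (fc V t y) (lift ord0 i) z = fc V t (upd y i z) by rewrite !E.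
  apply/ffunP => j; rewrite !ffunE; case: (unliftP ord0 j) => [j' ->|->] /=.
    by rewrite (inj_eq lift_inj) ?ffunE.
  by [].
have F0 y : F (fc V (\sum_j a ord0 j *: u j) y) =
    \sum_j a ord0 j *: F (fc V (u j) y).
  have E t : F (fc V t y) = F (upd (fc V 0 y) ord0 t).
    congr F; apply/ffunP => j; rewrite !ffunE.
    case: (unliftP ord0 j) => [j' ->|->] //=.
  rewrite E; under [RHS]eq_bigr => j _ do rewrite E.
  exact: linear_sumZ (mF (fc V 0 y) ord0) _ _ _.
rewrite (fcE _ [ffun i => _]) !ffunE F0.
rewrite (reindex (fun p : 'I_n * {ffun 'I_k -> 'I_n} => fc 'I_n p.1 p.2)) /=; last first.
  exists (fun z : {ffun 'I_k.+1 -> 'I_n} =>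
    (z ord0, [ffun i => z (lift ord0 i)])) => [[t y] _|z _] /=; last first.
    by rewrite -fcE.
  by congr pair; [rewrite fc0|apply/ffunP => i; rewrite ffunE fcS].
rewrite -(pair_bigA _ (fun j f => (\prod_i a i (fc 'I_n j f i)) *:
   F [ffun i => u (fc 'I_n j f i)])) /=.
apply: eq_bigr => j _.
have -> : [ffun i => [ffun i0 => \sum_j0 a i0 j0 *: u j0] (lift ord0 i)] =
   [ffun i => \sum_j0 a (lift ord0 i) j0 *: u j0].
  by apply/ffunP => i; rewrite !ffunE.
rewrite (IH _ (mFt (u j))) scaler_sumr; apply: eq_bigr => f _.
rewrite scalerA big_ord_recl fc0; congr (_ * _ *: F _).
  by apply: eq_bigr => i _; rewrite fcS.
apply/ffunP => i; rewrite !ffunE.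
by case: (unliftP ord0 i) => [i' _|_] /=; rewrite ?ffunE.
Qed.


Definition permute k (x : {ffun 'I_k -> V}) (s : 'S_k) : {ffun 'I_k -> V} :=
  [ffun i => x (s i)].

Lemma permuteM k (x : {ffun 'I_k -> V}) (s t : 'S_k) :
  permute x (s * t)%g = permute (permute x t) s.
Proof. by apply/ffunP => i; rewrite !ffunE permM. Qed.

Lemma alternating_adj (W : lmodType K) k (F : {ffun 'I_k -> V} -> W) :
  multilinear F -> alternating F ->
  forall (i j : 'I_k) x, j = i.+1 :> nat -> F (permute x (tperm i j)) = - F x.
Proof.
move=> mF aF i j x ij; have nij : i != j by rewrite -val_eqE /= ij; lia.
pose y u v := upd (upd x i u) j v.
have yi u v : y u v i = u by rewrite !ffunE (negPf nij) eqxx.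
have yj u v : y u v j = v by rewrite !ffunE eqxx.
have y0 u : F (y u u) = 0 by apply: (aF _ i j) => //; rewrite yi yj.
have yDr u v w : F (y u (v + w)) = F (y u v) + F (y u w).
  by have := mF (upd x i u) j 1 v w; rewrite !scale1r.
have yC u v : y u v = upd (upd x j v) i u.
  apply/ffunP => h; rewrite !ffunE; case: eqP => [->|//].
  by rewrite eq_sym (negPf nij).
have yDl u v w : F (y (u + v) w) = F (y u w) + F (y v w).
  by have := mF (upd x j w) i 1 u v; rewrite !yC !scale1r.
have -> : permute x (tperm i j) = y (x j) (x i).
  apply/ffunP => h; rewrite !ffunE; case: tpermP => [->|->|/eqP hi /eqP hj].
  - by rewrite (negPf nij) eqxx.
  - by rewrite eqxx.
  - by rewrite (negPf hi) (negPf hj).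
have yx : F (y (x i) (x j)) = F x by rewrite /y !upd_id.
have := y0 (x i + x j); rewrite yDl !yDr !y0 add0r addr0 addrC => /eqP.
by rewrite addr_eq0 yx => /eqP.
Qed.

Lemma alternating_perm (W : lmodType K) k (F : {ffun 'I_k -> V} -> W) :
  multilinear F -> alternating F ->
  forall x (s : 'S_k), F (permute x s) = (-1) ^+ s *: F x.
Proof.
move=> mF aF.
have trsp d (i j : 'I_k) x : j = (i + d).+1 :> nat ->
    F (permute x (tperm i j)) = - F x.
  elim: d i j x => [|d IH] i j x ij.
    by apply: alternating_adj => //; rewrite ij addn0.
  have hk : (i.+1 < k)%N by have := ltn_ord j; lia.
  pose h := Ordinal hk.
  have nih : i != h by rewrite -val_eqE /=; lia.
  have nij : i != j by rewrite -val_eqE /= ij; lia.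
  have nhj : h != j by rewrite -val_eqE /= ij; lia.
  have [hi ji] : h != i /\ j != i by rewrite ![_ == i]eq_sym.
  have -> : tperm i j = (tperm i h * tperm h j * tperm i h)%g.
    apply/permP => l; rewrite !permM.
    case: (tpermP i j l) => [->|->|/eqP li /eqP lj].
    - by rewrite tpermL tpermL tpermD // eq_sym.
    - by rewrite (tpermD nij nhj) tpermR tpermR.
    - have [->|lh] := eqVneq l h.
        by rewrite tpermR (tpermD hi ji) tpermL.
      have [il jl hl] : [/\ i != l, j != l & h != l] by split; rewrite eq_sym //; apply/eqP.
      by rewrite !tpermD.
  rewrite !permuteM (alternating_adj mF aF) // IH; last by rewrite ij /=; lia.
  by rewrite (alternating_adj mF aF) // !opprK.
have trsp' (i j : 'I_k) x : i != j -> F (permute x (tperm i j)) = - F x.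
  rewrite -val_eqE neq_ltn => /orP[] /= ij.
    by apply: (trsp (j - i.+1)%N); lia.
  by rewrite tpermC; apply: (trsp (i - j.+1)%N); lia.
move=> x s; have [ts -> /allP ts_p] := prod_tpermP s.
elim: ts ts_p x => [|t ts IH] ts_p x.
  rewrite big_nil odd_perm1 expr0 scale1r; congr F.
  by apply/ffunP => i; rewrite ffunE perm1.
have tP : t.1 != t.2 by apply: ts_p; rewrite mem_head.
rewrite big_cons permuteM trsp' // IH; last first.
  by move=> t' t'P; apply: ts_p; rewrite in_cons t'P orbT.
by rewrite odd_permM odd_tperm tP signr_addb expr1 mulN1r scaleNr.
Qed.

End Multilinear.

Section Exterior.
Variables (K : numFieldType) (V : vectType K).

(* The tensor power V^{(x)k}, presented by coordinates in the basis vbasis {:V}.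
   Nothing below depends on the basis: every operation is given by its value on
   pure tensors (tlift_ptens) or on decomposable elements (elift_wedge). *)
Definition tensor k := {ffun {ffun 'I_k -> 'I_(\dim {:V})} -> K^o}.
HB.instance Definition _ k := Vector.on (tensor k).

Definition basisv (i : 'I_(\dim {:V})) : V := tnth (vbasis {:V}) i.

Definition coordv (i : 'I_(\dim {:V})) (v : V) : K := coord (vbasis {:V}) i v.

(* x_0 (x) ... (x) x_{k-1} *)
Definition ptens k (x : {ffun 'I_k -> V}) : tensor k :=
  [ffun f : {ffun 'I_k -> 'I_(\dim {:V})} => \prod_i coordv (f i) (x i)].

Definition tprod p q (S : tensor p) (T : tensor q) : tensor (p + q) :=
  [ffun f : {ffun 'I_(p + q) -> 'I_(\dim {:V})} =>
     S [ffun i => f (lshift q i)] * T [ffun j => f (rshift p j)]].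

(* The linear map on V^{(x)k} whose value on each pure tensor ptens x is F x,
   for F multilinear (tlift_ptens). *)
Definition tlift k (W : lmodType K) (F : {ffun 'I_k -> V} -> W) (T : tensor k) : W :=
  \sum_(f : {ffun 'I_k -> 'I_(\dim {:V})}) T f *: F [ffun i => basisv (f i)].

Definition alt k (T : tensor k) : tensor k :=
  tlift (fun x => \sum_(s : 'S_k) (-1) ^+ s *: ptens (permute x s)) T.

Lemma tlift_linear k (W : lmodType K) (F : {ffun 'I_k -> V} -> W) : linear (tlift F).
Proof.
move=> a S T; rewrite /tlift scaler_sumr -big_split; apply: eq_bigr => f _ /=.
by rewrite scalerA -scalerDl !ffunE.
Qed.
HB.instance Definition _ k (W : lmodType K) F :=
  GRing.isLinear.Build K (tensor k) W _ (@tlift k W F) (tlift_linear F).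

Lemma alt_linear k : linear (@alt k).
Proof. exact: tlift_linear. Qed.
HB.instance Definition _ k :=
  GRing.isLinear.Build K (tensor k) (tensor k) _ (@alt k) (@alt_linear k).

(* Lambda^k V inside V^{(x)k}, spanned by the antisymmetrised tensors *)
Definition extpow k : {vspace tensor k} := limg (linfun (@alt k)).
Definition ext k := subvs_of (extpow k).
HB.instance Definition _ k := Vector.on (ext k).

Fact alt_mem k (T : tensor k) : alt T \in extpow k.
Proof. by rewrite -[alt T]lfunE memv_img ?memvf. Qed.

(* x_0 /\ ... /\ x_{k-1} = Alt(x_0 (x) ... (x) x_{k-1}) *)
Definition wedge k (x : {ffun 'I_k -> V}) : ext k := Subvs (alt_mem (ptens x)).

Definition wedge2 (u v : V) : ext 2 := wedge [ffun i : 'I_2 => [:: u; v]`_i].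

(* The linear map on Lambda^k V whose value on each wedge x is F x, for F
   multilinear and alternating (elift_wedge). *)
Definition elift k (W : lmodType K) (F : {ffun 'I_k -> V} -> W) (A : ext k) : W :=
  (k`!%:R)^-1 *: tlift F (vsval A).

Definition catv p q (x : {ffun 'I_p -> V}) (y : {ffun 'I_q -> V}) :
    {ffun 'I_(p + q) -> V} :=
  [ffun i => match split i with inl j => x j | inr j => y j end].

Definition ewedge p q (A : ext p) (B : ext q) : ext (p + q) :=
  elift (fun x => elift (fun y => wedge (catv x y)) B) A.

Lemma coordvE v : v = \sum_i coordv i v *: basisv i.
Proof.
rewrite {1}(coord_vbasis (memvf v)); apply: eq_bigr => i _.
by rewrite /basisv (tnth_nth 0).
Qed.

Lemma tlift_ptens k (W : lmodType K) (F : {ffun 'I_k -> V} -> W) :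
  multilinear F -> forall x, tlift F (ptens x) = F x.
Proof.
move=> mF x; have -> : F x = F [ffun i => \sum_j coordv j (x i) *: basisv j].
  by congr F; apply/ffunP => i; rewrite ffunE -coordvE.
by rewrite multilinear_sum //; apply: eq_bigr => f _; rewrite ffunE.
Qed.


Lemma ptens_multilinear k : multilinear (@ptens k).
Proof.
move=> x i a u v; apply/ffunP => f.
have E w : ptens (upd x i w) f = coordv (f i) w * \prod_(j | j != i) coordv (f j) (x j).
  rewrite ffunE (bigD1 i) //= !ffunE eqxx; congr (_ * _).
  by apply: eq_bigr => j /negPf ji; rewrite ffunE ji.
have DE (S T : tensor k) : (a *: S + T) f = a * S f + T f by rewrite !ffunE.
by rewrite DE !E /coordv linearP mulrDl -mulrA.
Qed.

Lemma permute_upd k (x : {ffun 'I_k -> V}) i u (s : 'S_k) :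
  permute (upd x i u) s = upd (permute x s) ((s^-1)%g i) u.
Proof.
by apply/ffunP => j; rewrite !ffunE (can2_eq (permK s) (permKV s)).
Qed.

Lemma altsum_multilinear (W : lmodType K) k (F : {ffun 'I_k -> V} -> W) :
  multilinear F ->
  multilinear (fun x => \sum_(s : 'S_k) (-1) ^+ s *: F (permute x s)).
Proof.
move=> mF x i a u v; rewrite scaler_sumr -big_split; apply: eq_bigr => s _ /=.
by rewrite !permute_upd mF scalerDr !scalerA mulrC.
Qed.

Lemma alt_ptens k (x : {ffun 'I_k -> V}) :
  alt (ptens x) = \sum_(s : 'S_k) (-1) ^+ s *: ptens (permute x s).
Proof. by apply: tlift_ptens (altsum_multilinear (@ptens_multilinear k)) _. Qed.

Lemma wedge_multilinear k : multilinear (@wedge k).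
Proof.
move=> x i a u v; apply: val_inj => /=.
by rewrite ptens_multilinear linearP.
Qed.

Lemma sum_sign_double k (W : lmodType K) (G : 'S_k -> W) (t : 'S_k) :
  odd_perm t -> (forall s, G (s * t)%g = G s) ->
  \sum_(s : 'S_k) (-1) ^+ s *: G s = 0.
Proof.
move=> ot Gt; set S := \sum_s _.
have SN : S = - S.
  rewrite {1}/S (reindex_inj (mulIg t)) -sumrN; apply: eq_bigr => s _.
  by rewrite odd_permM ot Gt signr_addb mulrN1 scaleNr.
have : 2%:R *: S = 0 by rewrite scaler_nat mulr2n {2}SN subrr.
by move/eqP; rewrite scaler_eq0 pnatr_eq0 /= => /eqP.
Qed.

Lemma wedge_eq0 k (x : {ffun 'I_k -> V}) (i j : 'I_k) :
  i != j -> x i = x j -> wedge x = 0.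
Proof.
move=> nij xij; apply: val_inj; rewrite /= alt_ptens.
apply: (@sum_sign_double _ _ _ (tperm i j)) => [|s]; first by rewrite odd_tperm.
rewrite permuteM; congr (ptens (permute _ s)); apply/ffunP => h; rewrite ffunE.
by case: tpermP => [->|->|].
Qed.

Lemma wedge_alternating k : alternating (@wedge k).
Proof.
move=> x i j ij; apply: wedge_eq0.
by rewrite -val_eqE /= ij; lia.
Qed.

Lemma wedge_permute k (x : {ffun 'I_k -> V}) (s : 'S_k) :
  wedge (permute x s) = (-1) ^+ s *: wedge x.
Proof.
exact: alternating_perm (@wedge_multilinear k) (@wedge_alternating k) x s.
Qed.

Lemma elift_linear k (W : lmodType K) (F : {ffun 'I_k -> V} -> W) : linear (elift F).
Proof.
move=> a A B; rewrite /elift [vsval _]linearP [tlift _ _]linearP scalerDr.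
by rewrite !scalerA mulrC.
Qed.

Lemma elift_wedge k (W : lmodType K) (F : {ffun 'I_k -> V} -> W) :
  multilinear F -> alternating F -> forall x, elift F (wedge x) = F x.
Proof.
move=> mF aF x; rewrite /elift /= alt_ptens [tlift _ _]raddf_sum /=.
have E (s : 'S_k) : tlift F ((-1) ^+ s *: ptens (permute x s)) = F x.
  rewrite linearZ /= tlift_ptens // alternating_perm // scalerA -expr2.
  by rewrite sqrr_sign scale1r.
rewrite (eq_bigr (fun=> F x)) => [|s _]; last exact: E.
rewrite sumr_const card_Sn -scaler_nat scalerA mulVf ?scale1r //.
by rewrite pnatr_eq0 -lt0n fact_gt0.
Qed.

Lemma ext_sum k (A : ext k) :
  exists T : tensor k, A = \sum_f T f *: wedge [ffun i => basisv (f i)].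
Proof.
case: A => A HA; have /memv_imgP[T _ AT] := HA; exists T; apply: val_inj.
rewrite /= raddf_sum /= AT lfunE /= /alt /tlift; apply: eq_bigr => f _.
by rewrite -alt_ptens.
Qed.

Lemma eq_ext k (W : lmodType K) (g h : ext k -> W) : linear g -> linear h ->
  (forall x, g (wedge x) = h (wedge x)) -> g =1 h.
Proof.
move=> lg lh gh A; have [T ->] := ext_sum A; rewrite !linear_sumZ //.
by apply: eq_bigr => f _; rewrite gh.
Qed.

Lemma elift_id k : elift (@wedge k) =1 id.
Proof.
apply: eq_ext => [|//|x]; first exact: elift_linear.
exact: elift_wedge (@wedge_multilinear k) (@wedge_alternating k) x.
Qed.

Lemma ewedge_wedge p q (x : {ffun 'I_p -> V}) (y : {ffun 'I_q -> V}) :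
  ewedge (wedge x) (wedge y) = wedge (catv x y).
Proof.
have catl x' i z : catv (upd x' i z) y = upd (catv x' y) (lshift q i) z.
  apply/ffunP => j; rewrite !ffunE; case: (splitP j) => h jh.
    by rewrite ffunE -!val_eqE /= jh.
  by rewrite -!val_eqE /= jh; case: eqP => // hi; have := ltn_ord i; lia.
have catr x' y' i z : catv x' (upd y' i z) = upd (catv x' y') (rshift p i) z.
  apply/ffunP => j; rewrite !ffunE; case: (splitP j) => h jh.
    by rewrite -!val_eqE /= jh; case: eqP => // hi; have := ltn_ord h; lia.
  by rewrite ffunE -!val_eqE /= jh eqn_add2l.
have cl x' y' (i : 'I_p) : catv x' y' (lshift q i) = x' i.
  by rewrite ffunE (unsplitK (inl i)).
have cr x' y' (i : 'I_q) : catv x' y' (rshift p i) = y' i.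
  by rewrite ffunE (unsplitK (inr i)).
have El (x' : {ffun 'I_p -> V}) : elift (fun y => wedge (catv x' y)) (wedge y) = wedge (catv x' y).
  apply: (elift_wedge (F := fun y => wedge (catv x' y))) => [y' i a u v|y' i j ij y'ij].
    by rewrite /= !catr wedge_multilinear.
  by apply: (wedge_alternating (i := rshift p i) (j := rshift p j)); rewrite ?cr //= ij addnS.
rewrite /ewedge -(El x).
apply: (elift_wedge (F := fun x => elift (fun y => wedge (catv x y)) (wedge y))).
  by move=> x' i a u v; rewrite /= !El !catl wedge_multilinear.
move=> x' i j ij x'ij; rewrite El.
by apply: (wedge_alternating (i := lshift q i) (j := lshift q j)); rewrite ?cl.
Qed.

(* The sum over i < j of (-1)^(i+j) m(x_i, x_j) /\ x_0 /\ ... /\ x_{k}, with x_i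
   and x_j omitted; indices start at 0, which leaves the parity of i + j unchanged.
   For k = 0 the sum is empty. *)
Definition boundary (m : 'Hom(ext 2, V)) k (A : ext k.+1) : ext k :=
  elift (fun x => \sum_(i < k.+1) \sum_(j < k.+1 | (i < j)%N) (-1) ^+ (i + j) *:
    wedge [ffun l : 'I_k => (m (wedge2 (x i) (x j)) ::
      [seq x h | h <- enum 'I_k.+1 & (h != i) && (h != j)])`_l]) A.

Definition adjoint (m : 'Hom(ext 2, V)) (v : V) k (A : ext k) : ext k :=
  elift (fun x => \sum_i wedge (upd x i (m (wedge2 v (x i))))) A.

(* g (x) 1 (x) ... (x) 1 *)
Definition cobracket_tens (g : 'Hom(V, ext 2)) k (T : tensor k.+1) : tensor k.+2 :=
  tlift (fun x => tprod (vsval (g (x ord0))) (ptens [ffun i => x (lift ord0 i)])) T.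

Lemma wedge_zero k (x : {ffun 'I_k -> V}) i : x i = 0 -> wedge x = 0.
Proof.
move=> xi; rewrite -(upd_id x i) xi.
have := wedge_multilinear x i (-1) 0 0.
by rewrite /= !scaleN1r !addNr.
Qed.

Lemma wedge2Pl a u v w : wedge2 (a *: u + v) w = a *: wedge2 u w + wedge2 v w.
Proof.
have E z : wedge2 z w = wedge (upd [ffun i : 'I_2 => [:: 0; w]`_i] ord0 z).
  by congr wedge; apply/ffunP => -[[|[|//]] ?]; rewrite !ffunE.
by rewrite !E wedge_multilinear.
Qed.

Lemma wedge2Pr a u v w : wedge2 w (a *: u + v) = a *: wedge2 w u + wedge2 w v.
Proof.
have E z : wedge2 w z = wedge (upd [ffun i : 'I_2 => [:: w; 0]`_i] ord_max z).
  by congr wedge; apply/ffunP => -[[|[|//]] ?]; rewrite !ffunE.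
by rewrite !E wedge_multilinear.
Qed.

Lemma wedge2_xx u : wedge2 u u = 0.
Proof. by apply: (wedge_eq0 (i := ord0) (j := ord_max)); rewrite ?ffunE. Qed.

Section Boundary.
Variables (m : 'Hom(ext 2, V)) (k : nat).
Let F := (fun x : {ffun 'I_k.+1 -> V} =>
  \sum_(i < k.+1) \sum_(j < k.+1 | (i < j)%N) (-1) ^+ (i + j) *:
    wedge [ffun l : 'I_k => (m (wedge2 (x i) (x j)) ::
      [seq x h | h <- enum 'I_k.+1 & (h != i) && (h != j)])`_l]).
Let r (i j : 'I_k.+1) := [seq h <- enum 'I_k.+1 | (h != i) && (h != j)].
Let t w (x : {ffun 'I_k.+1 -> V}) i j : ext k :=
  wedge [ffun l : 'I_k => (w :: [seq x h | h <- r i j])`_l].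

Let size_r i j : i != j -> (size (r i j)).+2 = k.+1.
Proof.
move=> nij; pose P (h : 'I_k.+1) := (h != i) && (h != j).
have := count_predC P (enum 'I_k.+1); rewrite size_enum_ord.
rewrite -size_filter -/(r i j); suff -> : count (predC P) (enum 'I_k.+1) = 2%N by rewrite addn2.
rewrite -size_filter -[2%N]/(size [:: i; j]); apply/perm_size/uniq_perm.
- exact/filter_uniq/enum_uniq.
- by rewrite /= inE nij.
- by move=> h; rewrite mem_filter mem_enum !inE /P /= negb_and !negbK andbT.
Qed.

Let mem_r i j h : (h \in r i j) = (h != i) && (h != j).
Proof. by rewrite mem_filter mem_enum andbT. Qed.

Let t_upd w x i j h u : h \in r i j -> i != j ->
  exists hk : ((index h (r i j)).+1 < k)%N, t w (upd x h u) i j =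
    wedge (upd [ffun l : 'I_k => (w :: [seq x h | h <- r i j])`_l] (Ordinal hk) u).
Proof.
move=> hr nij; have hk : ((index h (r i j)).+1 < k)%N.
  by have := index_mem h (r i j); rewrite hr; have := size_r nij; lia.
exists hk; congr wedge; apply/ffunP => -[[|l] lk]; rewrite !ffunE //= -val_eqE /= eqSS.
have lr : (l < size (r i j))%N by have := size_r nij; lia.
rewrite !(nth_map h) // ffunE -(nth_uniq h lr _ (filter_uniq _ (enum_uniq _))) ?index_mem //.
by rewrite nth_index.
Qed.

Let t_upd0 w x i j h u : h \notin r i j -> t w (upd x h u) i j = t w x i j.
Proof.
move=> hr; congr wedge; apply/ffunP => l; rewrite !ffunE; congr ((_ :: _)`_ _).
by apply/eq_in_map => l' l'r; rewrite ffunE; case: eqP l'r hr => // -> ->.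
Qed.

Let t_linear x i j a w1 w2 : (0 < k)%N ->
  t (a *: w1 + w2) x i j = a *: t w1 x i j + t w2 x i j.
Proof.
move=> k0; have E w : t w x i j =
   wedge (upd [ffun l : 'I_k => (0 :: [seq x h | h <- r i j])`_l] (Ordinal k0) w).
  by congr wedge; apply/ffunP => -[[|l] lk]; rewrite !ffunE.
by rewrite !E wedge_multilinear.
Qed.

Lemma boundary_multilinear : multilinear F.
Proof.
move=> x h a u v; rewrite /F scaler_sumr -big_split; apply: eq_bigr => i _ /=.
rewrite scaler_sumr -big_split; apply: eq_bigr => j ij /=.
have nij : i != j by rewrite -val_eqE neq_ltn ij.
have k0 : (0 < k)%N by have := ltn_ord j; lia.
rewrite scalerA mulrC -scalerA -scalerDr -/(r i j) -!/(t _ _ i j); congr (_ *: _).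
have [hr|hr] := boolP (h \in r i j).
  move: (hr); rewrite mem_r => /andP[/negPf hi /negPf hj].
  rewrite !ffunE ![_ == h]eq_sym hi hj.
  have [hk ->] := t_upd (m (wedge2 (x i) (x j))) x (a *: u + v) hr nij.
  have [hk1 ->] := t_upd (m (wedge2 (x i) (x j))) x u hr nij.
  have [hk2 ->] := t_upd (m (wedge2 (x i) (x j))) x v hr nij.
  by rewrite (bool_irrelevance hk1 hk) (bool_irrelevance hk2 hk) wedge_multilinear.
rewrite !t_upd0 // -t_linear // !ffunE; congr t.
move: hr; rewrite mem_r negb_and !negbK => /orP[]/eqP ->; rewrite eqxx.
  by rewrite eq_sym (negPf nij) -linearP wedge2Pl.
by rewrite (negPf nij) -linearP wedge2Pr.
Qed.

Let swap_r (x : {ffun 'I_k.+1 -> V}) (a b c : 'I_k.+1) : b = a.+1 :> nat -> x a = x b ->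
  c != a -> c != b ->
  [seq x h | h <- enum 'I_k.+1 & (h != a) && (h != c)] =
  [seq x h | h <- enum 'I_k.+1 & (h != b) && (h != c)].
Proof.
move=> ab xab ca cb.
have Ee : enum 'I_k.+1 = take a (enum 'I_k.+1) ++ [:: a, b & drop b.+1 (enum 'I_k.+1)].
  rewrite -{1}(cat_take_drop a (enum 'I_k.+1)) (drop_nth a) ?size_enum_ord //.
  rewrite nth_ord_enum; congr (_ ++ _ :: _).
  by rewrite -ab (drop_nth a) ?size_enum_ord // nth_ord_enum.
have := enum_uniq 'I_k.+1; rewrite Ee; move: (take _ _) (drop _ _) => s1 s2.
rewrite cat_uniq /= !inE !negb_or => /and3P[_ /and3P[as1 bs1 _]].
move=> /and3P[/andP[_ as2] bs2 _].
have fE s : a \notin s -> b \notin s -> [seq h <- s | (h != a) && (h != c)] =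
    [seq h <- s | (h != b) && (h != c)].
  move=> as' bs; apply: eq_in_filter => h hs.
  by rewrite (memPn as') // (memPn bs).
have nab : a != b by rewrite -val_eqE /= ab; lia.
rewrite !filter_cat (fE s1) //= !eqxx nab [b == a]eq_sym nab ![_ == c]eq_sym ca cb /=.
by rewrite (fE s2) // !map_cat /= xab.
Qed.

Lemma boundary_alternating : alternating F.
Proof.
move=> x a b ab xab; rewrite /F pair_big_dep /=.
have nab : a != b by rewrite -val_eqE /= ab; lia.
rewrite (bigD1 (a, b)) /=; last by rewrite ab.
rewrite xab wedge2_xx linear0.
have k0 : (0 < k)%N by have := ltn_ord b; lia.
rewrite (@wedge_zero _ _ (Ordinal k0)) ?ffunE //= scaler0 add0r.
set S := \sum_(p | _) _.
have SN : S = - S.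
  pose tau := tperm a b.
  have tauK : involutive (fun p : 'I_k.+1 * 'I_k.+1 => (tau p.1, tau p.2)).
    by move=> [i j] /=; rewrite !tpermK.
  have xtau h : x (tau h) = x h by rewrite /tau; case: tpermP => [->|->|].
  rewrite {1}/S (reindex_inj (inv_inj tauK)) /= -sumrN.
  apply: eq_big => [[i j]|[i j]] /=.
    rewrite !xpair_eqE -!val_eqE /= /tau.
    have T (h : 'I_k.+1) : [\/ h = a :> nat /\ tperm a b h = b :> nat,
        h = b :> nat /\ tperm a b h = a :> nat |
        [/\ h <> a :> nat, h <> b :> nat & tperm a b h = h :> nat]].
      case: tpermP => [->|->|ha hb]; [by constructor 1|by constructor 2|].
      by constructor 3; split=> // /val_inj.
    by case: (T i) => [[]|[]|[]]; case: (T j) => [[]|[]|[]]; lia.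
  rewrite !xtau => /andP[]; rewrite xpair_eqE.
  have Ew w c d c' d' : [seq x h | h <- r c d] = [seq x h | h <- r c' d'] ->
      t w x c d = t w x c' d'.
    by move=> e; congr wedge; apply/ffunP => l; rewrite !ffunE e.
  have tC w c d : t w x c d = t w x d c.
    by apply: Ew; congr map; apply: eq_filter => h; rewrite andbC.
  rewrite -!/(r _ _) -!/(t _ _ _ _) /tau.
  have [|nia] := eqVneq i a.
    move=> ->; rewrite tpermL; case: tpermP => [->|->|/eqP ja /eqP jb].
    - by rewrite ltnn.
    - by move=> lt _; lia.
    - by move=> _ _; rewrite (Ew _ _ _ _ _ (swap_r ab xab ja jb)) ab addSn exprS mulN1r scaleNr.
  have [|nib] := eqVneq i b.
    move=> ->; rewrite tpermR; case: tpermP => [->|->|/eqP ja /eqP jb].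
    - by rewrite !eqxx.
    - by rewrite ltnn.
    - by move=> _ _; rewrite (Ew _ _ _ _ _ (swap_r ab xab ja jb)) ab addSn exprS mulN1r scaleNr opprK.
  rewrite (tpermD (x := a)) 1?eq_sym //.
  case: tpermP => [->|->|/eqP ja /eqP jb] lij _.
  - by rewrite ![t _ _ i _]tC (Ew _ _ _ _ _ (swap_r ab xab nia nib)) ab addnS exprS mulN1r scaleNr.
  - by rewrite ![t _ _ i _]tC (Ew _ _ _ _ _ (swap_r ab xab nia nib)) ab addnS exprS mulN1r scaleNr opprK.
  have nij : i != j by rewrite -val_eqE neq_ltn lij.
  have az : a \in r i j by rewrite mem_r ![a == _]eq_sym nia ja.
  have bz : b \in r i j by rewrite mem_r ![b == _]eq_sym nib jb.
  have ik c : c \in r i j -> ((index c (r i j)).+1 < k)%N.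
    by rewrite -index_mem; have := size_r nij; lia.
  have -> : t (m (wedge2 (x i) (x j))) x i j = 0.
    apply: (wedge_eq0 (i := Ordinal (ik a az)) (j := Ordinal (ik b bz))).
      rewrite -val_eqE /= eqSS; apply: contra nab => /eqP e.
      by rewrite -(nth_index a az) e nth_index.
    by rewrite !ffunE /= !(nth_map a) ?index_mem // !nth_index.
  by rewrite !scaler0 oppr0.
have : 2%:R *: S = 0 by rewrite scaler_nat mulr2n {2}SN subrr.
by move/eqP; rewrite scaler_eq0 pnatr_eq0 /= => /eqP.
Qed.

End Boundary.

Lemma boundary_wedge m k (x : {ffun 'I_k.+1 -> V}) :
  boundary m (wedge x) =
  \sum_(i < k.+1) \sum_(j < k.+1 | (i < j)%N) (-1) ^+ (i + j) *:
    wedge [ffun l : 'I_k => (m (wedge2 (x i) (x j)) ::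
      [seq x h | h <- enum 'I_k.+1 & (h != i) && (h != j)])`_l].
Proof.
exact: (elift_wedge (@boundary_multilinear m k) (@boundary_alternating m k)).
Qed.

Lemma adjoint_wedge m v k (x : {ffun 'I_k -> V}) :
  adjoint m v (wedge x) = \sum_i wedge (upd x i (m (wedge2 v (x i)))).
Proof.
apply: (elift_wedge (F := fun x => \sum_i wedge (upd x i (m (wedge2 v (x i)))))).
  move=> y h a u w; rewrite scaler_sumr -big_split; apply: eq_bigr => i _ /=.
  have [->|nih] := eqVneq i h.
    have E z t : upd (upd y h z) h t = upd y h t.
      by apply/ffunP => j; rewrite !ffunE; case: eqP.
    by rewrite !E !ffunE eqxx wedge2Pr linearP wedge_multilinear.
  have E z t : upd (upd y h z) i t = upd (upd y i t) h z.
    apply/ffunP => j; rewrite !ffunE; case: (eqVneq j i) => // ->.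
    by rewrite (negPf nih).
  by rewrite !E !ffunE (negPf nih) wedge_multilinear.
move=> y a b ab yab; have nab : a != b by rewrite -val_eqE /= ab; lia.
rewrite (bigD1 a) //= (bigD1 b) /=; last by rewrite eq_sym.
rewrite big1 ?addr0 => [|i /andP[ia ib]]; last first.
  by apply: (wedge_eq0 nab); rewrite !ffunE ![_ == i]eq_sym (negPf ia) (negPf ib).
set w := m (wedge2 v (y b)); rewrite yab -/w.
have -> : upd y b w = permute (upd y a w) (tperm a b).
  apply/ffunP => j; rewrite !ffunE; case: tpermP => [->|->|/eqP ja /eqP jb].
  - by rewrite (negPf nab) eq_sym (negPf nab).
  - by rewrite !eqxx.
  - by rewrite (negPf ja) (negPf jb).
by rewrite wedge_permute odd_tperm nab expr1 scaleN1r subrr.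
Qed.

Lemma cobracket_tens_ptens g k (x : {ffun 'I_k.+1 -> V}) :
  cobracket_tens g (ptens x) =
  tprod (vsval (g (x ord0))) (ptens [ffun i => x (lift ord0 i)]).
Proof.
apply: (tlift_ptens (F := fun x : {ffun 'I_k.+1 -> V} =>
  tprod (vsval (g (x ord0))) (ptens [ffun i => x (lift ord0 i)]))).
have tPl p q a (S S' : tensor p) (T : tensor q) :
    tprod (a *: S + S') T = a *: tprod S T + tprod S' T.
  by apply/ffunP => f; rewrite !ffunE mulrDl -mulrA.
have tPr p q a (S S' : tensor p) (T : tensor q) :
    tprod T (a *: S + S') = a *: tprod T S + tprod T S'.
  by apply/ffunP => f; rewrite !ffunE mulrDr mulrCA.
move=> y h a u w; case: (unliftP ord0 h) => [j ->|->]; last first.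
  have E z : [ffun i => upd y ord0 z (lift ord0 i)] = [ffun i => y (lift ord0 i)].
    by apply/ffunP => i; rewrite !ffunE.
  by rewrite !E !ffunE eqxx !linearP tPl.
have E z : [ffun i => upd y (lift ord0 j) z (lift ord0 i)] =
    upd [ffun i => y (lift ord0 i)] j z.
  by apply/ffunP => i; rewrite !ffunE (inj_eq lift_inj).
by rewrite !E !ffunE ptens_multilinear tPr.
Qed.

End Exterior.

Arguments tensor {K} V k.
Arguments extpow {K} V k.
Arguments ext {K} V k.

Section Duality.
Variables (K : numFieldType) (V : vectType K).

Definition dual := 'Hom(V, K^o).
HB.instance Definition _ := Vector.on dual.

Definition dbasis (i : 'I_(\dim {:V})) : dual := linfun (fun v : V => coordv i v : K^o).

(* <xi_0 /\ ... /\ xi_{k-1}, x_0 /\ ... /\ x_{k-1}> = det (<xi_i, x_j>) *)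
Definition pairing k (A : ext dual k) (X : ext V k) : K^o :=
  elift (fun xi : {ffun 'I_k -> dual} => elift (fun x : {ffun 'I_k -> V} =>
    \det (\matrix_(i, j) (xi i (x j) : K)) : K^o) X) A.

(* The transposes of u : Lambda^p V -> Lambda^q V and of
   u : Lambda^p V^* -> Lambda^q V^* for the pairing above; see
   pairing_transpl and pairing_transpr. *)
Definition transpl p q (u : ext V p -> ext V q) (A : ext dual q) : ext dual p :=
  (p`!%:R)^-1 *: \sum_(f : {ffun 'I_p -> 'I_(\dim {:V})})
     pairing A (u (wedge [ffun i => basisv (f i)])) *: wedge [ffun i => dbasis (f i)].

Definition transpr p q (u : ext dual p -> ext dual q) (X : ext V q) : ext V p :=
  (p`!%:R)^-1 *: \sum_(f : {ffun 'I_p -> 'I_(\dim {:V})})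
     pairing (u (wedge [ffun i => dbasis (f i)])) X *: wedge [ffun i => basisv (f i)].

Lemma dbasisE i v : dbasis i v = coordv i v.
Proof.
have lc : linear (fun v : V => coordv i v : K^o).
  by move=> a u w; rewrite /coordv linearP.
pose c : {linear V -> K^o} := HB.pack (fun v : V => coordv i v : K^o)
  (GRing.isLinear.Build K V K^o _ (fun v : V => coordv i v : K^o) lc).
exact: (lfunE c v).
Qed.

Lemma det_multilinearr k (xi : {ffun 'I_k -> dual}) :
  multilinear (fun x : {ffun 'I_k -> V} => \det (\matrix_(i, j) (xi i (x j) : K)) : K^o).
Proof.
move=> x h a u v; pose M (y : {ffun 'I_k -> V}) := \matrix_(i, j) (xi j (y i) : K).
have trM (y : {ffun 'I_k -> V}) : \det (\matrix_(i, j) (xi i (y j) : K)) = \det (M y).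
  by rewrite -det_tr; congr (\det _); apply/matrixP => i j; rewrite !mxE.
have rowM z : row' h (M (upd x h z)) = row' h (M x).
  by apply/matrixP => i j; rewrite !mxE !ffunE eq_sym (negPf (neq_lift _ _)).
rewrite /= !trM.
suff -> : \det (M (upd x h (a *: u + v))) =
    a * \det (M (upd x h u)) + 1 * \det (M (upd x h v)) by rewrite mul1r.
apply: (determinant_multilinear (i0 := h)); rewrite ?rowM //.
by apply/rowP => j; rewrite !mxE !ffunE eqxx mul1r linearP.
Qed.

Lemma det_alternatingr k (xi : {ffun 'I_k -> dual}) :
  alternating (fun x : {ffun 'I_k -> V} => \det (\matrix_(i, j) (xi i (x j) : K)) : K^o).
Proof.
move=> x a b ab xab; have nab : a != b by rewrite -val_eqE /= ab; lia.
by rewrite -det_tr (determinant_alternate nab) // => j; rewrite !mxE xab.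
Qed.

Lemma pairing_wedger k (xi : {ffun 'I_k -> dual}) (x : {ffun 'I_k -> V}) :
  elift (fun x : {ffun 'I_k -> V} => \det (\matrix_(i, j) (xi i (x j) : K)) : K^o)
    (wedge x) = \det (\matrix_(i, j) (xi i (x j) : K)).
Proof. exact: (elift_wedge (@det_multilinearr k xi) (@det_alternatingr k xi)). Qed.

Lemma pairing_wedge k (xi : {ffun 'I_k -> dual}) (x : {ffun 'I_k -> V}) :
  pairing (wedge xi) (wedge x) = \det (\matrix_(i, j) (xi i (x j) : K)).
Proof.
rewrite -pairing_wedger /pairing.
apply: (elift_wedge (F := fun xi : {ffun 'I_k -> dual} =>
  elift (fun x : {ffun 'I_k -> V} => \det (\matrix_(i, j) (xi i (x j) : K)) : K^o)
    (wedge x))).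
  move=> y h a u v; rewrite /= !pairing_wedger.
  pose M (z : {ffun 'I_k -> dual}) := \matrix_(i, j) (z i (x j) : K).
  have rowM z : row' h (M (upd y h z)) = row' h (M y).
    by apply/matrixP => i j; rewrite !mxE !ffunE eq_sym (negPf (neq_lift _ _)).
  suff E : \det (M (upd y h (a *: u + v))) =
      a * \det (M (upd y h u)) + 1 * \det (M (upd y h v)) by rewrite mul1r in E.
  apply: (determinant_multilinear (i0 := h)); rewrite ?rowM //.
  by apply/rowP => j; rewrite !mxE !ffunE eqxx mul1r add_lfunE scale_lfunE.
move=> y a b ab yab; have nab : a != b by rewrite -val_eqE /= ab; lia.
by rewrite pairing_wedger (determinant_alternate nab) // => j; rewrite !mxE yab.
Qed.

Lemma pairing_linearl k (X : ext V k) : linear (fun A => pairing A X).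
Proof. exact: elift_linear. Qed.

Lemma pairing_linearr k (A : ext dual k) : linear (pairing A).
Proof.
move=> a X Y.
pose G (f : {ffun 'I_k -> 'I_(\dim {:dual})}) := elift (fun x : {ffun 'I_k -> V} =>
  \det (\matrix_(i, j) ((basisv (f i) : dual) (x j) : K)) : K^o).
have E Z : pairing A Z =
    (k`!%:R)^-1 *: \sum_(f : {ffun 'I_k -> 'I_(\dim {:dual})}) vsval A f *: G f Z.
  rewrite /pairing /elift /tlift; congr (_ *: _); apply: eq_bigr => f _.
  congr (_ *: _); rewrite /G /elift /tlift; congr (_ *: _); apply: eq_bigr => g _.
  congr (_ *: _); congr (\det _); apply/matrixP => i j; by rewrite !mxE !ffunE.
rewrite !E (scalerA a) (mulrC a) -scalerA -scalerDr; congr (_ *: _).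
rewrite scaler_sumr -big_split; apply: eq_bigr => f _ /=.
by rewrite (scalerA a) (mulrC a) -scalerA -scalerDr /G [elift _ _]elift_linear.
Qed.

Lemma ext_expand k (X : ext V k) :
  X = (k`!%:R)^-1 *: \sum_(f : {ffun 'I_k -> 'I_(\dim {:V})})
    pairing (wedge [ffun i => dbasis (f i)]) X *: wedge [ffun i => basisv (f i)].
Proof.
rewrite -{1}(elift_id X) /elift /tlift; congr (_ *: _); apply: eq_bigr => f _.
congr (_ *: _); move: X; apply: (eq_ext (W := K^o) (g := fun X : ext V k => vsval X f)
  (h := pairing (wedge [ffun i => dbasis (f i)]))) => [a A B||x].
- by rewrite [vsval _]linearP !ffunE.
- exact: pairing_linearr.
rewrite pairing_wedge /= alt_ptens sum_ffunE; apply: eq_bigr => s _.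
rewrite !ffunE; congr (_ * _); apply: eq_bigr => i _.
by rewrite !mxE !ffunE dbasisE.
Qed.

Lemma ext_dual_expand k (A : ext dual k) :
  A = (k`!%:R)^-1 *: \sum_(f : {ffun 'I_k -> 'I_(\dim {:V})})
    pairing A (wedge [ffun i => basisv (f i)]) *: wedge [ffun i => dbasis (f i)].
Proof.
move: A; apply: (eq_ext (g := id)) => [//|a A B|xi].
  rewrite (scalerA a) (mulrC a) -scalerA -scalerDr; congr (_ *: _).
  rewrite scaler_sumr -big_split; apply: eq_bigr => f _ /=.
  by rewrite (pairing_linearl _ a A B : _ = a * _ + _) scalerDl scalerA.
have xiE i : xi i = \sum_j xi i (basisv j) *: dbasis j.
  apply/lfunP => v; rewrite {1}(coordvE v) linear_sum sum_lfunE; apply: eq_bigr => j _ /=.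
  by rewrite linearZ scale_lfunE dbasisE; apply: mulrC.
have sE s : wedge xi = \sum_(f : {ffun 'I_k -> 'I_(\dim {:V})})
    ((-1) ^+ odd_perm s * \prod_i xi i (basisv (f (s i)))) *: wedge [ffun i => dbasis (f i)].
  rewrite [LHS](_ : _ = (-1) ^+ odd_perm s *: wedge (permute xi s^-1)); last first.
    by rewrite wedge_permute scalerA odd_permV -expr2 sqrr_sign scale1r.
  have -> : permute xi s^-1 = [ffun i => \sum_j xi (s^-1 i)%g (basisv j) *: dbasis j].
    by apply/ffunP => i; rewrite !ffunE -xiE.
  rewrite (multilinear_sum (@wedge_multilinear _ _ k)) scaler_sumr.
  apply: eq_bigr => f _; rewrite scalerA; congr (_ * _ *: _).
  rewrite (reindex_inj (@perm_inj _ s)); apply: eq_bigr => i _; by rewrite permK.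
transitivity ((k`!%:R)^-1 *: \sum_(s : 'S_k) wedge xi).
  rewrite sumr_const card_Sn -scaler_nat scalerA mulVf ?scale1r //.
  by rewrite pnatr_eq0 -lt0n fact_gt0.
congr (_ *: _); rewrite (eq_bigr _ (fun s _ => sE s)) exchange_big /=.
apply: eq_bigr => f _; rewrite -scaler_suml; congr (_ *: _).
rewrite pairing_wedge; apply: eq_bigr => s _; congr (_ * _).
by apply: eq_bigr => i _; rewrite !mxE !ffunE.
Qed.

Lemma pairing_transpl p q (u : ext V p -> ext V q) A X :
  linear u -> pairing (transpl u A) X = pairing A (u X).
Proof.
move=> lu; rewrite {2}(ext_expand X).
pose mu := fun X => pairing A (u X).
have lmu : linear mu by move=> a Y Z; rewrite /mu lu pairing_linearr.
pose L : {linear ext V p -> K^o} := HB.pack mu (GRing.isLinear.Build K _ K^o _ mu lmu).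
pose nu := fun A => pairing A X.
pose N : {linear ext dual p -> K^o} := HB.pack nu
  (GRing.isLinear.Build K _ K^o _ nu (pairing_linearl X)).
rewrite -[LHS]/(N _) -[RHS]/(L _) /transpl !linearZ !linear_sum; congr (_ *: _).
apply: eq_bigr => f _; rewrite !linearZ /=; exact: mulrC.
Qed.

Lemma pairing_transpr p q (u : ext dual p -> ext dual q) A X :
  linear u -> pairing A (transpr u X) = pairing (u A) X.
Proof.
move=> lu; rewrite {2}(ext_dual_expand A).
pose mu := fun A => pairing (u A) X.
have lmu : linear mu by move=> a Y Z; rewrite /mu lu pairing_linearl.
pose L : {linear ext dual p -> K^o} := HB.pack mu (GRing.isLinear.Build K _ K^o _ mu lmu).
pose nu := pairing A.
pose N : {linear ext V p -> K^o} := HB.pack nu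
  (GRing.isLinear.Build K _ K^o _ nu (pairing_linearr A)).
rewrite -[LHS]/(N _) -[RHS]/(L _) /transpr !linearZ !linear_sum; congr (_ *: _).
apply: eq_bigr => f _; rewrite !linearZ /=; exact: mulrC.
Qed.

(* The bracket on V^* dual to g : V -> Lambda^2 V:
   <g(x), xi /\ eta> = - <x, [xi, eta]>. *)
Definition dual_bracket (g : 'Hom(V, ext V 2)) : 'Hom(ext dual 2, dual) :=
  linfun (fun A : ext dual 2 => linfun (fun x : V => - pairing A (g x)) : dual).

Lemma dual_bracketE g A x : dual_bracket g A x = - pairing A (g x).
Proof.
have l2 B : linear (fun x : V => - pairing B (g x)).
  by move=> a u v; rewrite linearP pairing_linearr opprD scalerN.
pose c2 B : {linear V -> K^o} := HB.pack (fun x : V => - pairing B (g x))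
  (GRing.isLinear.Build K V K^o _ (fun x : V => - pairing B (g x)) (l2 B)).
have E2 B y : (linfun (fun x : V => - pairing B (g x)) : dual) y = - pairing B (g y).
  exact: (lfunE (c2 B) y).
pose h := fun A : ext dual 2 => linfun (fun x : V => - pairing A (g x)) : dual.
have l1 : linear h.
  move=> a B C; apply/lfunP => y; rewrite add_lfunE scale_lfunE !E2.
  by rewrite pairing_linearl opprD scalerN.
pose c1 : {linear ext dual 2 -> dual} := HB.pack h
  (GRing.isLinear.Build K (ext dual 2) dual _ h l1).
by rewrite /dual_bracket (lfunE c1) /= E2.
Qed.

End Duality.

Arguments dual {K} V.

Section LieQuasiBialgebra.
Variables (K : numFieldType) (G : vectType K).
Variables (mu : 'Hom(ext G 2, G)) (gamma : 'Hom(G, ext G 2)) (phi : ext G 3).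

(* Antisymmetry is built in, the bracket being defined on Lambda^2 G. *)
Definition jacobi : Prop := forall x y z : G,
  mu (wedge2 x (mu (wedge2 y z))) + mu (wedge2 y (mu (wedge2 z x))) +
  mu (wedge2 z (mu (wedge2 x y))) = 0.

Record lie_quasi_bialgebra : Prop := LieQuasiBialgebra {
  lqb_jacobi : jacobi;
  lqb_cocycle : forall x y : G,
    gamma (mu (wedge2 x y)) = adjoint mu x (gamma y) - adjoint mu y (gamma x);
  lqb_cojacobi : forall x : G,
    2%:R^-1 *: alt (cobracket_tens gamma (vsval (gamma x))) =
    - vsval (adjoint mu x phi);
  lqb_phi : alt (cobracket_tens gamma (vsval phi)) = 0 }.

Definition bd_mu k : ext G k.+1 -> ext G k := @boundary _ _ mu k.
Definition d_mu k : ext (dual G) k -> ext (dual G) k.+1 := transpl (@bd_mu k).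
Definition bd_gamma k : ext (dual G) k.+1 -> ext (dual G) k :=
  @boundary _ _ (dual_bracket gamma) k.
Definition d_gamma k : ext G k -> ext G k.+1 := transpr (@bd_gamma k).

(* bd_mu and bd_gamma map Lambda^0 to Lambda^{-1} = 0, hence the absence of the
   second term in degree 0. *)
Definition laplacian k : ext G k -> ext G k :=
  match k with
  | 0%N => fun X => bd_mu (d_gamma X)
  | _.+1 => fun X => bd_mu (d_gamma X) + d_gamma (bd_mu X)
  end.

Definition laplacian_dual k : ext (dual G) k -> ext (dual G) k :=
  match k with
  | 0%N => fun A => bd_gamma (d_mu A)
  | _.+1 => fun A => d_mu (bd_gamma A) + bd_gamma (d_mu A)
  end.

End LieQuasiBialgebra.

(* A derivation of degree 0 of the graded algebra Lambda V, given by its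
   homogeneous components D k : Lambda^k V -> Lambda^k V. *)
Definition derivation0 (K : numFieldType) (V : vectType K)
    (D : forall k, ext V k -> ext V k) : Prop :=
  (forall k, linear (D k)) /\
  (forall p q (A : ext V p) (B : ext V q),
     D _ (ewedge A B) = ewedge (D _ A) B + ewedge A (D _ B)).

(* Main.v *)
Require Import Defs.
From HB Require Import structures.
From mathcomp Require Import all_boot all_order all_fingroup all_algebra.
From mathcomp Require Import reals complex ring zify.

Set Implicit Arguments.
Unset Strict Implicit.
Unset Printing Implicit Defensive.

Import Order.TTheory GRing.Theory Num.Theory.
Local Open Scope ring_scope.

(** Write e_v for the left multiplication X |-> v /\ X by a vector v. These maps
    generate the exterior algebra from the scalars, so an operator is determined by
    its value on scalars and its graded commutators with all e_v. Two of them drive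
    the proof: the boundary of mu satisfies [bd, e_v] = - ad_v ([bd_lmul]), and the
    coboundary d of the cobracket satisfies [d, e_v] = e_(gamma v), the product by
    the bivector gamma v ([cobd_lmul]).

    For the Laplacian L = [bd, d] the graded Jacobi identity then gives
    [L, e_v] = [bd, e_(gamma v)] + [ad_v, d]. The first term is the product by
    - mu (gamma v) plus the Schouten bracket S_v with gamma v, and the anticommutator
    of S_v + [ad_v, d] with e_w is the product by
    ad_v (gamma w) - ad_w (gamma v) - gamma [v, w]. That bivector is zero because
    gamma is a cocycle, so S_v + [ad_v, d] = 0 ([ad_cobd]). Hence
    [L, e_v] = e_(l v) with l = - mu o gamma ([lap_lmul]), and since L vanishes on
    scalars it is the derivation that extends l.

    L commutes with bd because bd o bd = 0: both composites are then bd o d o bd. The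
    Jacobi identity of mu says that ad is a representation, this makes ad_v commute
    with bd, and this in turn makes bd o bd commute with every e_v ([ad_br], [ad_bd],
    [bd_bd]).

    On the dual side the transpose of e_v is the contraction i_v. Since d is defined as
    the transpose of the boundary of the dual bracket, [cobd_lmul] transposes the
    anticommutator of i_v with that boundary ([bd_contr]), which is computed on left
    multiplications by covectors. Transposing
    [L, e_v] = e_(l v) gives [i_v, L^*] = i_(l v) for the dual Laplacian L^*; as the
    contractions are jointly injective, this determines [L^*, e_xi] and shows that
    L^* is a derivation ([ldual_lmul]).

    Degree 0 is often a separate case, since bd and i_v are then maps to the zero
    space below the scalars and the corresponding term is absent. *)

(** * Linear identities in exterior powers *)

(** The four consequences of linearity, packaged as a multirule that rewrites
    with a plain function rather than with a bundled linear map. *)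
Lemma linear_rules (K : pzRingType) (U W : lmodType K) (g : U -> W) : linear g ->
  (forall A B, g (A + B) = g A + g B) * (forall a A, g (a *: A) = a *: g A) *
  (forall A, g (- A) = - g A) * (g 0 = 0).
Proof.
move=> lg; pose h : {linear U -> W} := HB.pack g (GRing.isLinear.Build K U W _ g lg).
by do !split=> *; [exact: (linearD h)|exact: (linearZ_LR h)|exact: (linearN h)|
  exact: (linear0 h)].
Qed.

Lemma linear_bigsum (K : pzRingType) (U W : lmodType K) (g : U -> W) : linear g ->
  forall (I : finType) (P : pred I) (u : I -> U),
  g (\sum_(i | P i) u i) = \sum_(i | P i) g (u i).
Proof.
by move=> lg I P u; have E := linear_rules lg; apply: big_morph => [A B|]; rewrite E.
Qed.

(** The concrete model of the exterior powers must stay out of sight of unification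
    while operators are computed with, so each operator is sealed behind this opaque
    key and is used only through its values on generators. *)
Fact seal : unit. Proof. exact: tt. Qed.

(** * Left multiplication by a vector *)

Section LeftMultiplication.
Variables (K : numFieldType) (V : vectType K).

Definition fcons k (v : V) (x : {ffun 'I_k -> V}) : {ffun 'I_k.+1 -> V} :=
  [ffun i => oapp x v (unlift ord0 i)].

Definition ftail k (x : {ffun 'I_k.+1 -> V}) : {ffun 'I_k -> V} :=
  [ffun i => x (lift ord0 i)].

Lemma fcons0 k v (x : {ffun 'I_k -> V}) : fcons v x ord0 = v.
Proof. by rewrite ffunE unlift_none. Qed.

Lemma fconsS k v (x : {ffun 'I_k -> V}) i : fcons v x (lift ord0 i) = x i.
Proof. by rewrite ffunE liftK. Qed.

Lemma fcons_eta k (x : {ffun 'I_k.+1 -> V}) : x = fcons (x ord0) (ftail x).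
Proof.
apply/ffunP => i; rewrite ffunE.
by case: (unliftP ord0 i) => [j ->|->] //=; rewrite ffunE.
Qed.

Lemma upd_fcons0 k v (x : {ffun 'I_k -> V}) u : upd (fcons v x) ord0 u = fcons u x.
Proof.
apply/ffunP => i; rewrite ffunE; case: (unliftP ord0 i) => [j ->|->].
  by rewrite !fconsS.
by rewrite eqxx !fcons0.
Qed.

Lemma upd_fconsS k v (x : {ffun 'I_k -> V}) i u :
  upd (fcons v x) (lift ord0 i) u = fcons v (upd x i u).
Proof.
apply/ffunP => j; rewrite ffunE; case: (unliftP ord0 j) => [h ->|->].
  by rewrite (inj_eq lift_inj) !fconsS ffunE.
by rewrite !fcons0.
Qed.

Definition lmul v k (A : ext V k) : ext V k.+1 :=
  locked_with seal (elift (fun x : {ffun 'I_k -> V} => wedge (fcons v x))) A.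

Lemma lmul_wedge v k (x : {ffun 'I_k -> V}) : lmul v (wedge x) = wedge (fcons v x).
Proof.
rewrite /lmul; case: seal.
apply: (elift_wedge (F := fun x => wedge (fcons v x))) => [y i a u w|y i j ij yij].
  by rewrite -!upd_fconsS wedge_multilinear.
by apply: (wedge_alternating (i := lift ord0 i) (j := lift ord0 j)); rewrite ?fconsS //= ij.
Qed.

Lemma lmul_linear v k : linear (@lmul v k).
Proof. by rewrite /lmul; case: seal; apply: elift_linear. Qed.
End LeftMultiplication.

Section Separation.
Variables (K : numFieldType) (V : vectType K).

Definition lmul_lin v k := linear_rules (@lmul_linear K V v k).

(** Linear functionals separate points, so a linear identity between elements of
    an exterior power may be checked in the commutative ring of scalars. *)
Lemma ext_separated k (A B : ext V k) :
  (forall f : {scalar ext V k}, f A = f B) -> A = B.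
Proof.
move=> AB; apply/val_inj/ffunP => i.
have li : scalar (fun A : ext V k => vsval A i : K).
  by move=> a C D; rewrite [vsval _]linearP !ffunE.
exact: (AB (HB.pack (fun A : ext V k => vsval A i : K) (GRing.isLinear.Build
  K _ K *%R (fun A : ext V k => vsval A i : K) li))).
Qed.

Lemma scalar_rules k (f : {scalar ext V k}) :
  [/\ f 0 = 0, forall A, f (- A) = - f A, forall A B, f (A + B) = f A + f B
    & forall a A, f (a *: A) = a * f A].
Proof.
by split=> [|A|A B|a A]; [exact: linear0|exact: linearN|exact: linearD|exact: linearZ].
Qed.

End Separation.

(** Decides linear identities in an exterior power. The scalar equation is produced by
    syntactic matching, since unification up to conversion would unfold the concrete
    model. The second call of ring covers terms that agree only up to the choice of
    the algebraic structures inferred in them, which generalization would separate. *)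
Ltac ext_ring :=
  let f := fresh "f" in let f0 := fresh in let fN := fresh in
  let fD := fresh in let fZ := fresh in
  apply: ext_separated => f; have [f0 fN fD fZ] := scalar_rules f;
  repeat match goal with
  | |- context [GRing.Linear.sort f (?A + ?B)] => rewrite (fD A B)
  | |- context [GRing.Linear.sort f (- ?A)] => rewrite (fN A)
  | |- context [GRing.Linear.sort f (?a *: ?A)] => rewrite (fZ a A)
  | |- context [GRing.Linear.sort f 0] => rewrite f0
  end;
  first
    [ solve [ repeat match goal with
        | |- context [?t] =>
            lazymatch t with GRing.Linear.sort f _ => generalize t; intro end
        end; ring ]
    | ring ].

Section Generation.
Variables (K : numFieldType) (V : vectType K).

Lemma lmul_linearl k (A : ext V k) : linear (fun v => lmul v A).
Proof.
move=> a u v; move: A; apply: eq_ext => [||x]; first exact: lmul_linear.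
  by move=> c A B; rewrite !lmul_lin; ext_ring.
have E z : fcons z x = upd (fcons 0 x) ord0 z by rewrite upd_fcons0.
by rewrite !lmul_wedge (E (_ + _)) (E u) (E v) wedge_multilinear.
Qed.
Definition lmul_linl k A := linear_rules (@lmul_linearl k A).

(** Elements of degree k + 1 are generated from degree k by left multiplications:
    this is the induction principle behind every operator identity below. *)
Lemma eq_ext_lmul (W : lmodType K) k (g h : ext V k.+1 -> W) : linear g -> linear h ->
  (forall v A, g (lmul v A) = h (lmul v A)) -> g =1 h.
Proof.
move=> lg lh gh; apply: eq_ext => // x.
by rewrite (fcons_eta x) -lmul_wedge gh.
Qed.

Definition ext1 : ext V 0 := wedge [ffun i : 'I_0 => 0].

Lemma eq_ext0 (W : lmodType K) (g h : ext V 0 -> W) : linear g -> linear h ->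
  g ext1 = h ext1 -> g =1 h.
Proof.
move=> lg lh gh; apply: eq_ext => // x.
by have -> : x = [ffun i : 'I_0 => 0] by apply/ffunP => -[].
Qed.

Lemma lmulC u v k (A : ext V k) : lmul u (lmul v A) = - lmul v (lmul u A).
Proof.
move: A; apply: eq_ext => [||x].
- by move=> a A B; rewrite !lmul_lin.
- by move=> a A B; rewrite !lmul_lin; ext_ring.
rewrite !lmul_wedge; pose i := lift ord0 (ord0 : 'I_k.+1).
have E : fcons u (fcons v x) = permute (fcons v (fcons u x)) (tperm ord0 i).
  apply/ffunP => j; rewrite [RHS]ffunE; case: tpermP => [->|->|].
  - by rewrite /i fconsS !fcons0.
  - by rewrite /i fconsS !fcons0.
  case: (unliftP ord0 j) => [j' ->|->] // _; rewrite !fconsS.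
  case: (unliftP ord0 j') => [j'' ->|->]; first by rewrite !fconsS.
  by rewrite /i.
by rewrite E wedge_permute odd_tperm (neq_lift ord0 ord0) expr1 scaleN1r.
Qed.

(** * Products *)

Definition eprod p q (A : ext V p) (B : ext V q) : ext V (p + q) :=
  locked_with seal (@ewedge K V p q) A B.

Lemma eprodE p q (A : ext V p) (B : ext V q) : eprod A B = ewedge A B.
Proof. by rewrite /eprod; case: seal. Qed.

Lemma eprod_linearl p q (B : ext V q) : linear (fun A : ext V p => eprod A B).
Proof. by rewrite /eprod; case: seal; apply: elift_linear. Qed.
Definition eprod_linl p q B := linear_rules (@eprod_linearl p q B).

(** Used for the linearity of products in their right factor, which is a parameter of
    the multilinear map that defines the product. *)
Lemma elift_linear_param (U W : lmodType K) k (F : U -> {ffun 'I_k -> V} -> W) A :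
  (forall x, linear (fun B => F B x)) -> linear (fun B => elift (F B) A).
Proof.
move=> lF a B C; rewrite /elift scalerA mulrC -scalerA -scalerDr; congr (_ *: _).
rewrite /tlift scaler_sumr -big_split; apply: eq_bigr => f _ /=.
by rewrite lF scalerDr !scalerA mulrC.
Qed.

Lemma eprod_linearr p q (A : ext V p) : linear (fun B : ext V q => eprod A B).
Proof.
rewrite /eprod; case: seal => /=; apply: elift_linear_param => x.
exact: elift_linear.
Qed.
Definition eprod_lin p q A := linear_rules (@eprod_linearr p q A).

Lemma eprod1 q (B : ext V q) : eprod ext1 B = B.
Proof.
move: B; apply: (eq_ext (g := fun B : ext V q => eprod ext1 B) (h := id)) => [|//|y].
  exact: eprod_linearr.
rewrite eprodE ewedge_wedge; congr wedge; apply/ffunP => i; rewrite ffunE.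
by case: splitP => [[]//|j ij]; congr (y _); apply: val_inj.
Qed.

Lemma eprod_lmul v p q (A : ext V p) (B : ext V q) :
  eprod (lmul v A) B = lmul v (eprod A B).
Proof.
move: A; apply: eq_ext => [||x].
- by move=> a A A'; rewrite !(lmul_lin, eprod_linl).
- by move=> a A A'; rewrite !(lmul_lin, eprod_linl).
move: B; apply: eq_ext => [||y].
- by move=> a A A'; rewrite !eprod_lin.
- by move=> a A A'; rewrite !(lmul_lin, eprod_lin).
rewrite lmul_wedge !eprodE !ewedge_wedge lmul_wedge; congr wedge; apply/ffunP => i.
case: (unliftP (ord0 : 'I_(p + q).+1) i) => [j ->|->]; last first.
  rewrite fcons0 ffunE (_ : ord0 = lshift q (ord0 : 'I_p.+1)); last exact: val_inj.
  by rewrite (unsplitK (inl _)) fcons0.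
rewrite fconsS !ffunE; case: (splitP j) => h jh.
  rewrite (_ : lift _ _ = lshift q (lift ord0 h)); last by apply: val_inj; rewrite /= jh.
  by rewrite (unsplitK (inl _)) fconsS.
rewrite (_ : lift _ _ = rshift p.+1 h); last by apply: val_inj; rewrite /= jh.
by rewrite (unsplitK (inr _)).
Qed.

(** The product by a bivector, with the degree in the form k.+2 that the operators
    of positive degree expect. *)
Definition bmul (B : ext V 2) k (X : ext V k) : ext V k.+2 :=
  locked_with seal (@eprod 2 k) B X.

Lemma bmulE B k (X : ext V k) : bmul B X = eprod B X.
Proof. by rewrite /bmul; case: seal. Qed.

Lemma bmul_linearl k (X : ext V k) : linear (fun B => bmul B X).
Proof. by rewrite /bmul; case: seal; apply: eprod_linearl. Qed.
Definition bmul_linl k X := linear_rules (@bmul_linearl k X).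

Lemma bmul_linearr B k : linear (@bmul B k).
Proof. by rewrite /bmul; case: seal; apply: (eprod_linearr (q := k) B). Qed.
Definition bmul_lin B k := linear_rules (@bmul_linearr B k).

Lemma wedge2_lmul u v : wedge2 u v = lmul u (lmul v ext1).
Proof.
rewrite !lmul_wedge; congr wedge; apply/ffunP => -[[|[|//]] lt2]; rewrite ffunE.
  by rewrite (_ : Ordinal _ = ord0) ?fcons0 //; apply: val_inj.
rewrite (_ : Ordinal _ = lift ord0 ord0); last exact: val_inj.
by rewrite fconsS fcons0.
Qed.

Lemma eq_ext2 (W : lmodType K) (g h : ext V 2 -> W) : linear g -> linear h ->
  (forall u v, g (wedge2 u v) = h (wedge2 u v)) -> g =1 h.
Proof.
move=> lg lh gh; apply: eq_ext => // x.
have -> // : wedge x = wedge2 (x ord0) (x (lift ord0 ord0)).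
congr wedge; apply/ffunP => -[[|[|//]] lt2]; rewrite ffunE; congr (x _); exact: val_inj.
Qed.

Lemma bmul_wedge2 u v q (B : ext V q) :
  bmul (wedge2 u v) B = lmul u (lmul v B).
Proof. by rewrite wedge2_lmul bmulE !eprod_lmul eprod1. Qed.

(** Reduces the Leibniz rule to a left factor of degree 1, by induction on its degree;
    it applies to ad, to the Laplacian and to the dual Laplacian. *)
Lemma leibniz_derivation0 (D : forall k, ext V k -> ext V k) (d : V -> V) :
  (forall k, linear (D k)) -> (forall A, D 0%N A = 0) ->
  (forall k v A, D k.+1 (lmul v A) = lmul (d v) A + lmul v (D k A)) ->
  forall p q (A : ext V p) (B : ext V q),
    D _ (eprod A B) = eprod (D _ A) B + eprod A (D _ B).
Proof.
move=> lD D0 DS p q A B; have DE k := linear_rules (lD k).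
elim: p A => [|p IH].
  apply: eq_ext0 => [a A C|a A C|]; last by rewrite D0 !eprod1 eprod_linl add0r.
    by rewrite !(eprod_linl, DE).
  by rewrite !(eprod_linl, DE); ext_ring.
apply: eq_ext_lmul => [a A C|a A C|v A].
- by rewrite !(eprod_linl, DE).
- by rewrite !(eprod_linl, DE); ext_ring.
by rewrite eprod_lmul !DS IH !(eprod_linl, lmul_lin) !eprod_lmul addrA.
Qed.

(** Moving the j-th factor to the front costs j transpositions. *)
Lemma wedge_upd k (x : {ffun 'I_k.+1 -> V}) (j : 'I_k.+1) w :
  lmul w (wedge [ffun i => x (lift j i)]) = (-1) ^+ j *: wedge (upd x j w).
Proof.
elim: k x j => [|k IH] x j.
  rewrite (ord1 j) scale1r lmul_wedge; congr wedge; apply/ffunP => i.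
  by rewrite (ord1 i) fcons0 ffunE eqxx.
case: (unliftP ord0 j) => [i ->|->]; last first.
  rewrite expr0 scale1r lmul_wedge [in RHS](fcons_eta x) upd_fcons0.
  by congr (wedge (fcons _ _)); apply/ffunP => h; rewrite !ffunE.
rewrite (_ : [ffun _ => _] = fcons (x ord0) [ffun h => ftail x (lift i h)]); last first.
  apply/ffunP => h; rewrite ffunE; case: (unliftP ord0 h) => [h' ->|->].
    by rewrite fconsS !ffunE; congr (x _); apply: val_inj; rewrite /= /bump /=; lia.
  by rewrite fcons0; congr (x _); apply: val_inj; rewrite /= /bump.
rewrite -lmul_wedge lmulC IH lmul_lin -scaleNr [in RHS](fcons_eta x) upd_fconsS.
by rewrite -lmul_wedge exprS mulN1r.
Qed.

End Generation.

(** * The boundary of a bracket *)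

Lemma enum_neq k (j : 'I_k.+1) :
  [seq h <- enum 'I_k.+1 | h != j] = [seq lift j i | i <- enum 'I_k].
Proof.
elim: k j => [|k IH] j.
  by rewrite (ord1 j) !enum_ordSl /= (size0nil (size_enum_ord 0)).
rewrite enum_ordSl /= filter_map; case: (unliftP ord0 j) => [i ->|->]; last first.
  by rewrite eqxx /= (eq_filter (a2 := predT)) ?filter_predT.
rewrite neq_lift (eq_filter (a2 := fun h => h != i)) => [|h]; last first.
  by rewrite /= (inj_eq lift_inj).
rewrite IH enum_ordSl /= -!map_comp; congr (_ :: _); first exact: val_inj.
by apply: eq_map => h; apply: val_inj; rewrite /= /bump /=; lia.
Qed.

Lemma wedge_seq_cons (K : numFieldType) (V : vectType K) k w (s : seq V) :
  wedge [ffun l : 'I_k.+1 => (w :: s)`_l] = lmul w (wedge [ffun l : 'I_k => s`_l]).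
Proof.
rewrite lmul_wedge; congr wedge; apply/ffunP => l; rewrite ffunE.
by case: (unliftP ord0 l) => [h ->|->]; rewrite ?fcons0 ?fconsS ?ffunE.
Qed.

Section Boundary.
Variables (K : numFieldType) (V : vectType K) (m : 'Hom(ext V 2, V)).

Definition br u v := m (wedge2 u v).
Definition ad v k (A : ext V k) : ext V k := locked_with seal (@adjoint K V m v k) A.
Definition bd k (A : ext V k.+1) : ext V k := locked_with seal (@boundary K V m k) A.

Lemma adE v k (A : ext V k) : ad v A = adjoint m v A.
Proof. by rewrite /ad; case: seal. Qed.

Lemma bdE k (A : ext V k.+1) : bd A = boundary m A.
Proof. by rewrite /bd; case: seal. Qed.

Lemma ad_linear v k : linear (@ad v k).
Proof. by rewrite /ad; case: seal; apply: elift_linear. Qed.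
Definition ad_lin v k := linear_rules (@ad_linear v k).

Lemma bd_linear k : linear (@bd k).
Proof. by rewrite /bd; case: seal; apply: elift_linear. Qed.
Definition bd_lin k := linear_rules (@bd_linear k).

Lemma br_linearl v : linear (fun u => br u v).
Proof. by move=> a u w; rewrite /br wedge2Pl linearP. Qed.

Lemma br_linearr u : linear (br u).
Proof. by move=> a v w; rewrite /br wedge2Pr linearP. Qed.

Lemma br_anti u v : br u v = - br v u.
Proof.
apply/eqP; rewrite -addr_eq0; apply/eqP; have := wedge2_xx (u + v).
have D := linear_rules (br_linearl _); have D' := linear_rules (br_linearr _).
move/(congr1 m); rewrite linear0 -/(br _ _) D !D' /br !wedge2_xx linear0.
by rewrite add0r addr0.
Qed.

Lemma ad_ext0 v (A : ext V 0) : ad v A = 0.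
Proof.
move: A; apply: (eq_ext (g := @ad v 0) (h := fun _ => 0)) => [||x].
- exact: ad_linear.
- by move=> a A B; rewrite scaler0 addr0.
by rewrite adE adjoint_wedge big_ord0.
Qed.

Lemma ad_lmul v w k (A : ext V k) : ad v (lmul w A) = lmul (br v w) A + lmul w (ad v A).
Proof.
move: A; apply: eq_ext => [||x].
- by move=> a A B; rewrite !(lmul_lin, ad_lin).
- by move=> a A B; rewrite !(lmul_lin, ad_lin); ext_ring.
rewrite lmul_wedge !adE !adjoint_wedge big_ord_recl fcons0 upd_fcons0 lmul_wedge.
congr (_ + _); rewrite (linear_bigsum (@lmul_linear _ _ w k)).
by apply: eq_bigr => i _; rewrite lmul_wedge fconsS upd_fconsS.
Qed.

(** The defect of the boundary from anticommuting with a left multiplication is the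
    adjoint action: moving the bracket of v with the j-th factor back to its slot
    costs the sign (-1) ^ j, and the pair (0, j + 1) has the opposite sign. *)
Lemma bd_lmul v k (A : ext V k.+1) : bd (lmul v A) = - ad v A - lmul v (bd A).
Proof.
move: A; apply: eq_ext => [||x].
- by move=> a A B; rewrite !(lmul_lin, bd_lin).
- by move=> a A B; rewrite !(lmul_lin, ad_lin, bd_lin); ext_ring.
rewrite lmul_wedge !bdE adE adjoint_wedge !boundary_wedge big_ord_recl.
congr (_ + _).
  rewrite -sumrN [LHS]big_mkcond big_ord_recl /= add0r; apply: eq_bigr => j _.
  rewrite fcons0 fconsS -/(br _ _).
  have -> : [seq fcons v x h | h <- enum 'I_k.+2 & (h != ord0) && (h != lift ord0 j)] =
     [seq x h | h <- enum 'I_k.+1 & h != j].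
    rewrite enum_ordSl /= filter_map -map_comp /=.
    rewrite (eq_filter (a2 := fun h => h != j)) => [|h]; last first.
      by rewrite /= (inj_eq lift_inj).
    by apply: eq_map => h; rewrite /= fconsS.
  rewrite wedge_seq_cons enum_neq -map_comp (_ : [ffun _ => _] = [ffun i => x (lift j i)]).
    rewrite wedge_upd scalerA add0n /bump leq0n add1n exprS mulN1r mulNr.
    by rewrite -expr2 sqrr_sign scaleN1r.
  apply/ffunP => l; rewrite !ffunE (nth_map l) ?size_enum_ord //= nth_ord_enum.
  by [].
rewrite (linear_bigsum (@lmul_linear _ _ v k)) -sumrN; apply: eq_bigr => i _.
rewrite (linear_bigsum (@lmul_linear _ _ v k)) -sumrN.
rewrite [LHS]big_mkcond big_ord_recl /= add0r [RHS]big_mkcond.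
apply: eq_bigr => j _; rewrite !fconsS -!/(br _ _) /bump !add1n ltnS.
case: ifP => // ij; rewrite addSn addnS !exprS !mulN1r opprK lmul_lin.
rewrite -scalerN; congr (_ *: _).
(* A pair i < j exists only from degree 2 on, so that v can be taken out of the wedge. *)
case: k x i j ij => [|k] x i j ij; first by rewrite (ord1 i) (ord1 j) in ij.
rewrite !wedge_seq_cons -lmulC; congr lmul.
rewrite -wedge_seq_cons; congr wedge; apply/ffunP => l; rewrite !ffunE; congr (_`_ _).
rewrite enum_ordSl /= filter_map -map_comp fcons0; congr (_ :: _).
rewrite (eq_filter (a2 := fun h => (h != i) && (h != j))) => [|h].
  by apply: eq_map => h; rewrite /= fconsS.
by rewrite /= !(inj_eq lift_inj).
Qed.

Lemma bd_ext1 (A : ext V 1) : bd A = 0.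
Proof.
move: A; apply: (eq_ext (g := @bd 0) (h := fun _ => 0)) => [||x].
- exact: bd_linear.
- by move=> a A B; rewrite scaler0 addr0.
rewrite bdE boundary_wedge big_ord_recl big_ord0 addr0 big_pred0 // => j.
by rewrite (ord1 j).
Qed.

Lemma bd_lmul0 v (A : ext V 0) : bd (lmul v A) = - ad v A.
Proof. by rewrite bd_ext1 ad_ext0 oppr0. Qed.

(** The part of the commutator of the boundary with the product by a bivector B that is
    not a product: it sends X to u /\ ad_v X - v /\ ad_u X when B = u /\ v. Defining it
    as a defect makes its linearity in B immediate. *)
Definition schouten (B : ext V 2) k : ext V k -> ext V k.+1 :=
  match k with
  | 0%N => fun X => bd (bmul B X) + lmul (m B) X
  | k'.+1 => fun X =>
     bd (bmul B X) - bmul B (bd X) + lmul (m B) X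
  end.

Lemma schouten0 B (X : ext V 0) : schouten B X = bd (bmul B X) + lmul (m B) X.
Proof. by []. Qed.

Lemma schoutenS B k (X : ext V k.+1) :
  schouten B X = bd (bmul B X) - bmul B (bd X) + lmul (m B) X.
Proof. by []. Qed.

Lemma schouten_linearl k (X : ext V k) : linear (fun B => schouten B X).
Proof.
move=> a B C; case: k X => [|k] X; rewrite /= linearP /=.
  by rewrite !(lmul_linl, bmul_linl, bd_lin); ext_ring.
by rewrite !(lmul_linl, bmul_linl, bd_lin); ext_ring.
Qed.

Lemma schouten_linear B k : linear (@schouten B k).
Proof.
case: k => [|k] a X Y /=; rewrite !(lmul_lin, bd_lin, bmul_lin); ext_ring.
Qed.
Definition schouten_lin B k := linear_rules (@schouten_linear B k).

Lemma schouten_wedge2 u v k (X : ext V k) :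
  schouten (wedge2 u v) X = lmul u (ad v X) - lmul v (ad u X).
Proof.
have E : m (wedge2 u v) = br u v by [].
case: k X => [|k] X; rewrite /= E !bmul_wedge2 bd_lmul.
  by rewrite bd_lmul0 !ad_lmul !ad_ext0 !lmul_lin; ext_ring.
by rewrite bd_lmul !ad_lmul !lmul_lin; ext_ring.
Qed.

Lemma schouten_ext0 B (X : ext V 0) : schouten B X = 0.
Proof.
move: B; apply: (eq_ext2 (h := fun _ => 0)) => [|a A C|u v].
- exact: schouten_linearl.
- by rewrite scaler0 addr0.
by rewrite schouten_wedge2 !ad_ext0 !lmul_lin subr0.
Qed.

(** The Schouten bracket with B is an antiderivation, as is seen on decomposable B. *)
Lemma schouten_lmul B w k (X : ext V k) :
  schouten B (lmul w X) = - lmul w (schouten B X) - bmul (ad w B) X.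
Proof.
have lS j (Y : ext V j) := linear_rules (schouten_linearl Y).
move: B; apply: eq_ext2 => [a A C|a A C|u v].
- by rewrite !lS.
- by rewrite !(lS, lmul_lin, ad_lin, bmul_linl); ext_ring.
rewrite !schouten_wedge2 wedge2_lmul !ad_lmul ad_ext0 !lmul_lin addr0.
rewrite -!wedge2_lmul bmul_linl !bmul_wedge2 [br w u]br_anti [br w v]br_anti.
rewrite !(lmul_lin, lmul_linl) [lmul u (lmul w _)]lmulC [lmul v (lmul w _)]lmulC.
by rewrite [lmul v (lmul (br u w) _)]lmulC; ext_ring.
Qed.

Lemma br_jacobi u v w (mJ : jacobi m) : br (br u v) w = br u (br v w) - br v (br u w).
Proof.
have := mJ u v w; rewrite -!/(br _ _) [br w u]br_anti [br w (br u v)]br_anti.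
rewrite (linear_rules (br_linearr v)) => /eqP; rewrite subr_eq0 => /eqP <-.
by [].
Qed.

(** Both sides are derivations that agree in degree 1, by the Jacobi identity. *)
Lemma ad_br u v k (A : ext V k) (mJ : jacobi m) :
  ad (br u v) A = ad u (ad v A) - ad v (ad u A).
Proof.
elim: k A => [|k IH] A; first by rewrite !ad_ext0 subr0.
move: A; apply: eq_ext_lmul => [a A B|a A B|w A].
- by rewrite !ad_lin.
- by rewrite !ad_lin; ext_ring.
by rewrite !(ad_lmul, ad_lin) br_jacobi // IH !(lmul_lin, lmul_linl); ext_ring.
Qed.

(** The commutator of ad_v with the boundary anticommutes with every left
    multiplication, because ad is a representation. *)
Lemma ad_bd v k (A : ext V k.+1) (mJ : jacobi m) : ad v (bd A) = bd (ad v A).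
Proof.
elim: k A => [|k IH] A; first by rewrite !bd_ext1 ad_lin.
move: A; apply: eq_ext_lmul => [a A B|a A B|w A].
- by rewrite !(ad_lin, bd_lin).
- by rewrite !(ad_lin, bd_lin).
by rewrite !(bd_lmul, ad_lmul, ad_lin, bd_lin) ad_br // IH; ext_ring.
Qed.

(** The square of the boundary commutes with every left multiplication: the two terms
    in which the boundary meets the adjoint action cancel. *)
Lemma bd_bd k (A : ext V k.+2) (mJ : jacobi m) : bd (bd A) = 0.
Proof.
elim: k A => [|k IH] A; first by rewrite bd_ext1.
move: A; apply: (eq_ext_lmul (h := fun _ => 0)) => [a A B|a A B|w A].
- by rewrite !bd_lin.
- by rewrite scaler0 addr0.
by rewrite !(bd_lmul, bd_lin) IH -ad_bd // lmul_lin; ext_ring.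
Qed.
End Boundary.

(** * Contractions, the transposes of left multiplications *)

Section Contraction.
Variables (K : numFieldType) (V : vectType K).

Definition pairing_linl k X := linear_rules (@pairing_linearl K V k X).
Definition pairing_lin k A := linear_rules (@pairing_linearr K V k A).

Lemma pairing_injl k (A B : ext (dual V) k) :
  (forall X, pairing A X = pairing B X) -> A = B.
Proof.
by move=> AB; rewrite (ext_dual_expand A) (ext_dual_expand B); under eq_bigr do rewrite AB.
Qed.

Lemma pairing_injr k (X Y : ext V k) : (forall A, pairing A X = pairing A Y) -> X = Y.
Proof.
by move=> XY; rewrite (ext_expand X) (ext_expand Y); under eq_bigr do rewrite XY.
Qed.

Definition contr v k (A : ext (dual V) k.+1) : ext (dual V) k :=
  locked_with seal (transpl (@lmul K V v k)) A.

Lemma pairing_contr v k (A : ext (dual V) k.+1) X :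
  pairing (contr v A) X = pairing A (lmul v X).
Proof. by rewrite /contr; case: seal; apply/pairing_transpl/lmul_linear. Qed.

Lemma contr_linear v k : linear (@contr v k).
Proof.
by move=> a A B; apply: pairing_injl => X; rewrite !(pairing_contr, pairing_linl).
Qed.
Definition contr_lin v k := linear_rules (@contr_linear v k).

Lemma contr_linearl k (A : ext (dual V) k.+1) : linear (fun v => contr v A).
Proof.
move=> a u v; apply: pairing_injl => X; rewrite !(pairing_contr, pairing_linl) lmul_linearl.
by rewrite !pairing_lin.
Qed.
Definition contr_linl k A := linear_rules (@contr_linearl k A).

(** Laplace expansion of the pairing determinant along the column of v. *)
Lemma contr_wedge v k (xi : {ffun 'I_k.+1 -> dual V}) :
  contr v (wedge xi) =
  \sum_(i < k.+1) ((-1) ^+ i * xi i v) *: wedge [ffun j => xi (lift i j)].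
Proof.
apply: pairing_injl; apply: eq_ext => [||x].
- exact: pairing_linearr.
- exact: pairing_linearr.
rewrite pairing_contr lmul_wedge pairing_wedge (expand_det_col _ ord0).
rewrite (linear_bigsum (@pairing_linearl K V k (wedge x))); apply: eq_bigr => i _.
rewrite (pairing_linl (wedge x)) pairing_wedge mxE fcons0 /cofactor addn0.
rewrite mulrA [xi i v * _]mulrC; congr (_ * \det _).
by apply/matrixP => p q; rewrite !mxE !ffunE liftK.
Qed.

Lemma contr_lmul0 v xi (A : ext (dual V) 0) : contr v (lmul xi A) = (xi v : K) *: A.
Proof.
move: A; apply: eq_ext => [a A B|a A B|x].
- by rewrite !(lmul_lin, contr_lin).
- by ext_ring.
rewrite lmul_wedge contr_wedge big_ord_recl big_ord0 addr0 mul1r fcons0.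
by congr (_ *: wedge _); apply/ffunP => -[].
Qed.

Lemma contr_lmul v xi k (A : ext (dual V) k.+1) :
  contr v (lmul xi A) = (xi v : K) *: A - lmul xi (contr v A).
Proof.
move: A; apply: eq_ext => [a A B|a A B|x].
- by rewrite !(lmul_lin, contr_lin).
- by rewrite !(lmul_lin, contr_lin); ext_ring.
rewrite lmul_wedge !contr_wedge big_ord_recl mul1r fcons0; congr (_ *: wedge _ + _).
  by apply/ffunP => i; rewrite ffunE fconsS.
rewrite (linear_bigsum (@lmul_linear _ _ xi k)) -sumrN; apply: eq_bigr => i _.
rewrite lmul_lin fconsS exprS mulN1r mulNr scaleNr lmul_wedge; congr (- (_ *: wedge _)).
apply/ffunP => j; rewrite !ffunE; case: (unliftP ord0 j) => [h ->|->] /=.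
  rewrite ffunE (_ : lift (lift ord0 i) (lift ord0 h) = lift ord0 (lift i h)) ?liftK //.
  by apply: val_inj; rewrite /= /bump /=; lia.
by rewrite (_ : lift _ _ = ord0) ?unlift_none //; apply: val_inj.
Qed.

Lemma pairing_ext1 : pairing (ext1 (dual V)) (ext1 V) = 1.
Proof. by rewrite pairing_wedge det_mx00. Qed.

Lemma pairing_wedge2 (xi eta : dual V) (u v : V) :
  pairing (wedge2 xi eta) (wedge2 u v) = xi u * eta v - xi v * eta u.
Proof.
rewrite !wedge2_lmul -!pairing_contr contr_lmul contr_lmul0.
rewrite !(lmul_lin, contr_lin) !contr_lmul0 !pairing_linl pairing_ext1.
have scE (a b : K) : a *: (b : K^o) = a * b by [].
by rewrite !scE !mulr1 [eta u * _]mulrC.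
Qed.

Definition contr2 B k (A : ext (dual V) k.+2) : ext (dual V) k :=
  locked_with seal (transpl (@bmul K V B k)) A.

Lemma pairing_contr2 B k (A : ext (dual V) k.+2) X :
  pairing (contr2 B A) X = pairing A (bmul B X).
Proof. by rewrite /contr2; case: seal; apply/pairing_transpl/bmul_linearr. Qed.

Lemma contr2_linear B k : linear (@contr2 B k).
Proof.
by move=> a C D; apply: pairing_injl => X; rewrite !(pairing_contr2, pairing_linl).
Qed.
Definition contr2_lin B k := linear_rules (@contr2_linear B k).

Lemma contr2_linearl k (A : ext (dual V) k.+2) : linear (fun B => contr2 B A).
Proof.
move=> a C D; apply: pairing_injl => X; rewrite !(pairing_contr2, pairing_linl) bmul_linearl.
by rewrite !pairing_lin.
Qed.
Definition contr2_linl k A := linear_rules (@contr2_linearl k A).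

Lemma contr2_wedge2 u v k (A : ext (dual V) k.+2) :
  contr2 (wedge2 u v) A = contr v (contr u A).
Proof. by apply: pairing_injl => X; rewrite pairing_contr2 bmul_wedge2 !pairing_contr. Qed.

(** The contraction of B by xi in its first slot, u /\ v |-> xi(u) v - xi(v) u: the
    commutator of the contraction by B with the left multiplication by xi is the
    contraction by this vector. *)
Definition slot (xi : dual V) (B : ext V 2) : V :=
  \sum_i pairing (wedge2 xi (dbasis i)) B *: basisv i.

Lemma slot_linear xi : linear (slot xi).
Proof.
move=> a B C; rewrite /slot scaler_sumr -big_split; apply: eq_bigr => i _ /=.
by rewrite pairing_linearr scalerDl [a *: (_ *: basisv _)]scalerA.
Qed.
Definition slot_lin xi := linear_rules (slot_linear xi).

Lemma slot_wedge2 xi u v : slot xi (wedge2 u v) = (xi u : K) *: v - (xi v : K) *: u.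
Proof.
rewrite [X in _ *: X - _](coordvE v) [X in _ - _ *: X](coordvE u) !scaler_sumr -sumrB.
by apply: eq_bigr => i _; rewrite pairing_wedge2 !dbasisE scalerBl !scalerA.
Qed.

Lemma pairing_slot (xi eta : dual V) B : eta (slot xi B) = pairing (wedge2 xi eta) B.
Proof.
move: B; apply: (eq_ext2 (W := K^o)) => [a B C|a B C|u v].
- by rewrite slot_linear linearP.
- by rewrite pairing_linearr.
by rewrite slot_wedge2 pairing_wedge2 linearB !linearZ.
Qed.

Lemma contr2_lmul1 B xi (A : ext (dual V) 1) :
  contr2 B (lmul xi A) = contr (slot xi B) A.
Proof.
move: B; apply: eq_ext2 => [a B C|a B C|u v].
- by rewrite !contr2_linl.
- by rewrite !(slot_lin, contr_linl).
rewrite contr2_wedge2 contr_lmul slot_wedge2.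
by rewrite !(contr_lin, contr_linl) contr_lmul0.
Qed.

Lemma contr2_lmul B xi k (A : ext (dual V) k.+2) :
  contr2 B (lmul xi A) = lmul xi (contr2 B A) + contr (slot xi B) A.
Proof.
move: B; apply: eq_ext2 => [a B C|a B C|u v].
- by rewrite !contr2_linl.
- by rewrite !(slot_lin, contr_linl, contr2_linl, lmul_lin); ext_ring.
rewrite !contr2_wedge2 slot_wedge2 !(contr_linl, contr_lmul, contr_lin).
by ext_ring.
Qed.

End Contraction.

(** * The coboundary of a cobracket *)

Section Cobracket.
Variables (K : numFieldType) (V : vectType K) (g : 'Hom(V, ext V 2)).
Let gb := dual_bracket g.

Lemma br_dual (xi eta : dual V) v : br gb xi eta v = - eta (slot xi (g v)).
Proof. by rewrite pairing_slot /br dual_bracketE. Qed.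

(** Both sides lower the degree by one and have the same anticommutator with the left
    multiplication by eta, the scalar eta (slot xi (g v)): on the left it arises as
    minus the value at v of the bracket of xi and eta. *)
Lemma ad_contr xi v k (A : ext (dual V) k.+1) :
  ad gb xi (contr v A) - contr v (ad gb xi A) = contr (slot xi (g v)) A.
Proof.
elim: k A => [|k IH]; apply: eq_ext_lmul => [a A B|a A B|eta A].
- by rewrite !(ad_lin, contr_lin); ext_ring.
- by rewrite !contr_lin.
- rewrite ad_ext0 ad_lmul ad_ext0 lmul_lin addr0 !contr_lmul0 br_dual.
  by ext_ring.
- by rewrite !(ad_lin, contr_lin); ext_ring.
- by rewrite !contr_lin.
rewrite !(ad_lmul, contr_lmul, contr_lin, ad_lin) br_dual -IH !lmul_lin.
by ext_ring.
Qed.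

(** By the graded Jacobi identity both sides have the same commutator with the left
    multiplication by xi: the boundary contributes ad_xi, which is handled by
    [ad_contr]. *)
Lemma bd_contr v k (A : ext (dual V) k.+2) :
  bd gb (contr v A) + contr v (bd gb A) = contr2 (g v) A.
Proof.
elim: k A => [|k IH]; apply: eq_ext_lmul => [a A B|a A B|xi A].
- by rewrite !(bd_lin, contr_lin); ext_ring.
- by rewrite !contr2_lin.
- rewrite bd_ext1 bd_lmul bd_ext1 lmul_lin subr0 contr_lin contr2_lmul1 -ad_contr.
  by rewrite ad_ext0; ext_ring.
- by rewrite !(bd_lin, contr_lin); ext_ring.
- by rewrite !contr2_lin.
rewrite bd_lmul contr2_lmul -IH -ad_contr !(contr_lmul, contr_lin, bd_lin).
by rewrite bd_lmul !lmul_lin; ext_ring.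
Qed.

Definition cobd k (X : ext V k) : ext V k.+1 :=
  locked_with seal (transpr (@bd K (dual V) gb k)) X.

Lemma cobdE k (X : ext V k) : cobd X = d_gamma g X.
Proof. by rewrite /cobd /d_gamma /bd_gamma /bd; case: seal. Qed.

Lemma pairing_cobd k (A : ext (dual V) k.+1) X :
  pairing A (cobd X) = pairing (bd gb A) X.
Proof. by rewrite /cobd; case: {1}seal; apply/pairing_transpr/bd_linear. Qed.

Lemma cobd_linear k : linear (@cobd k).
Proof.
by move=> a X Y; apply: pairing_injr => A; rewrite !(pairing_lin, pairing_cobd).
Qed.
Definition cobd_lin k := linear_rules (@cobd_linear k).

Lemma cobd_ext0 (X : ext V 0) : cobd X = 0.
Proof.
by apply: pairing_injr => A; rewrite pairing_cobd bd_ext1 pairing_linl pairing_lin.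
Qed.

(** The transpose of [bd_contr]: the coboundary is the antiderivation that extends g. *)
Lemma cobd_lmul v k (X : ext V k) :
  cobd (lmul v X) = bmul (g v) X - lmul v (cobd X).
Proof.
apply: pairing_injr => A; rewrite pairing_cobd -pairing_contr.
rewrite !pairing_lin -pairing_contr2 -pairing_contr pairing_cobd -bd_contr pairing_linl.
by rewrite addrAC subrr add0r.
Qed.
End Cobracket.

(** * The Laplacian *)

Section Laplacian.
Variables (K : numFieldType) (G : vectType K).
Variables (mu : 'Hom(ext G 2, G)) (g : 'Hom(G, ext G 2)).

Definition lap k (X : ext G k) : ext G k := locked_with seal (@laplacian K G mu g k) X.

Definition ldual k (A : ext (dual G) k) : ext (dual G) k :=
  locked_with seal (@laplacian_dual K G mu g k) A.

Lemma lapE k (X : ext G k) : lap X = laplacian mu g X.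
Proof. by rewrite /lap; case: seal. Qed.

Lemma ldualE k (A : ext (dual G) k) : ldual A = laplacian_dual mu g A.
Proof. by rewrite /ldual; case: seal. Qed.

Definition cocycle := forall x y : G,
  g (mu (wedge2 x y)) = adjoint mu x (g y) - adjoint mu y (g x).

Definition dmu k (A : ext (dual G) k) : ext (dual G) k.+1 :=
  locked_with seal (transpl (@bd K G mu k)) A.

Lemma dmuE k (A : ext (dual G) k) : dmu A = d_mu mu A.
Proof. by rewrite /dmu /d_mu /bd_mu /bd; case: seal. Qed.

Lemma pairing_dmu k (A : ext (dual G) k) X : pairing (dmu A) X = pairing A (bd mu X).
Proof. by rewrite /dmu; case: {1}seal; apply/pairing_transpl/bd_linear. Qed.

Lemma lap0 (X : ext G 0) : lap X = 0.
Proof. by rewrite lapE /= /bd_mu -cobdE -bdE cobd_ext0 bd_ext1. Qed.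

Lemma lapS k (X : ext G k.+1) :
  lap X = bd mu (cobd g X) + cobd g (bd mu X).
Proof. by rewrite lapE /= /bd_mu -!cobdE -!bdE. Qed.

Lemma lap_linear k : linear (@lap k).
Proof.
case: k => [|k] a X Y; first by rewrite !lap0 scaler0 addr0.
by rewrite !lapS !(bd_lin, cobd_lin); ext_ring.
Qed.

Lemma ldual0 (A : ext (dual G) 0) :
  ldual A = bd (dual_bracket g) (dmu A).
Proof. by rewrite ldualE /= /bd_gamma -dmuE -bdE. Qed.

Lemma ldualS k (A : ext (dual G) k.+1) :
  ldual A = dmu (bd (dual_bracket g) A) + bd (dual_bracket g) (dmu A).
Proof. by rewrite ldualE /= /bd_gamma -!dmuE -!bdE. Qed.

Lemma pairing_ldual k (A : ext (dual G) k) (X : ext G k) :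
  pairing (ldual A) X = pairing A (lap X).
Proof.
case: k A X => [|k] A X.
  by rewrite lap0 ldual0 bd_ext1 pairing_linl pairing_lin.
rewrite lapS ldualS !(pairing_linl, pairing_lin) pairing_dmu -!pairing_cobd.
by rewrite pairing_dmu addrC.
Qed.

(** The commutator of ad_v with the coboundary is minus the Schouten bracket with g v.
    Both are antiderivations, and their anticommutators with the left multiplication
    by w are the products by ad_v (g w) - g [v, w] and by ad_w (g v): these agree by
    the cocycle condition. *)
Lemma ad_cobd (gC : cocycle) v k (X : ext G k) :
  ad mu v (cobd g X) - cobd g (ad mu v X) + schouten mu (g v) X = 0.
Proof.
have gbr x y : g (br mu x y) = ad mu x (g y) - ad mu y (g x).
  by rewrite !adE -gC.
have ad_bmul B j (Y : ext G j) :
    ad mu v (bmul B Y) = bmul (ad mu v B) Y + bmul B (ad mu v Y).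
  have lD i := @ad_linear _ _ mu v i.
  have DS i w (C : ext G i) := ad_lmul mu v w C.
  by rewrite !bmulE; apply: (leibniz_derivation0 lD (@ad_ext0 _ _ mu v) DS B Y).
elim: k X => [|k IH].
  by move=> X; rewrite cobd_ext0 ad_ext0 !ad_lin cobd_ext0 schouten_ext0; ext_ring.
apply: (eq_ext_lmul (h := fun _ => 0)) => [a X Y|a X Y|w X].
- by rewrite !(ad_lin, cobd_lin, schouten_lin); ext_ring.
- by rewrite scaler0 addr0.
have /eqP := IH X; rewrite -addrA addr_eq0 => /eqP E.
rewrite cobd_lmul !(ad_lmul, ad_lin, cobd_lin) ad_bmul !cobd_lmul gbr schouten_lmul.
rewrite !bmul_linl E !lmul_lin; ext_ring.
Qed.

(** The Laplacian on vectors, with the vectors not yet regarded as elements of degree 1. *)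
Definition lap1 : 'Hom(G, G) := - (mu \o g)%VF.

Lemma lap1E v : lap1 v = - mu (g v).
Proof. by rewrite opp_lfunE comp_lfunE. Qed.

(** The bracket part of the commutator with the boundary is what remains once the
    Schouten bracket has been cancelled by [ad_cobd]. *)
Lemma lap_lmul (gC : cocycle) v k (X : ext G k) :
  lap (lmul v X) =
  lmul (lap1 v) X + lmul v (lap X).
Proof.
rewrite lap1E; case: k X => [|k] X.
  have /eqP := schouten_ext0 mu (g v) X; rewrite schouten0 addr_eq0 => /eqP E.
  rewrite lapS lap0 cobd_lmul bd_lmul0 cobd_ext0 ad_ext0.
  by rewrite !(bd_lin, cobd_lin, lmul_lin) E !lmul_linl; ext_ring.
have /eqP := ad_cobd gC v X; rewrite schoutenS !addrA addr_eq0 => /eqP E.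
have {}E : bd mu (bmul (g v) X) = cobd g (ad mu v X) - ad mu v (cobd g X)
    + bmul (g v) (bd mu X) - lmul (mu (g v)) X by rewrite -E; ext_ring.
rewrite !lapS cobd_lmul bd_lmul !(bd_lin, cobd_lin) E bd_lmul cobd_lmul.
by rewrite !(lmul_lin, lmul_linl); ext_ring.
Qed.

(** The transpose of [lap_lmul]. *)
Lemma contr_ldual (gC : cocycle) v k (A : ext (dual G) k.+1) :
  contr v (ldual A) =
  ldual (contr v A) + contr (lap1 v) A.
Proof.
apply: pairing_injl => X; rewrite pairing_linl !pairing_contr !pairing_ldual.
by rewrite lap_lmul // pairing_lin pairing_contr addrC.
Qed.

Lemma ldual_linear k : linear (@ldual k).
Proof.
by move=> a A B; apply: pairing_injl => X; rewrite !(pairing_linl, pairing_ldual).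
Qed.

Lemma contr_inj k (A B : ext (dual G) k.+1) :
  (forall v, contr v A = contr v B) -> A = B.
Proof.
move=> AB; apply: pairing_injl; apply: eq_ext_lmul => [||v X].
- exact: pairing_linearr.
- exact: pairing_linearr.
by rewrite -!pairing_contr AB.
Qed.

Lemma ldual_ext0 (A : ext (dual G) 0) : ldual A = 0.
Proof. by rewrite ldual0 bd_ext1. Qed.

(** Checked after contraction by an arbitrary v: contractions are jointly injective,
    their commutator with the dual Laplacian is known, and contracting the left
    multiplication by xi leaves a term of lower degree, to which induction applies. *)
Lemma ldual_lmul (gC : cocycle) (xi : dual G) k (A : ext (dual G) k) :
  ldual (lmul xi A) =
  lmul (xi \o lap1)%VF A + lmul xi (ldual A).
Proof.
have LE j := linear_rules (@ldual_linear j).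
have xiE v : (xi \o lap1)%VF v = xi (lap1 v) by rewrite comp_lfunE.
elim: k A => [|k IH] A; apply: contr_inj => v; rewrite contr_ldual //.
  rewrite !(contr_lmul0, contr_lin) !ldual_ext0 xiE.
  by ext_ring.
rewrite !(contr_lmul, contr_lin) xiE !LE IH contr_ldual // !lmul_lin.
by ext_ring.
Qed.

Lemma lap_bd (mJ : jacobi mu) k (X : ext G k.+1) :
  lap (bd mu X) = bd mu (lap X).
Proof.
rewrite lapS bd_lin bd_bd // add0r.
by case: k X => [|k] X; rewrite ?lap0 ?lapS ?bd_bd ?bd_ext1 ?cobd_lin ?addr0.
Qed.
End Laplacian.

Theorem proposition3p4 (R : realType) (b : scalar_kind)
    (G : vectType (scalars R b))
    (mu : 'Hom(ext G 2, G)) (gamma : 'Hom(G, ext G 2)) (phi : ext G 3)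
    (HG : lie_quasi_bialgebra mu gamma phi) :
  [/\ derivation0 (laplacian mu gamma),
      forall (k : nat) (A : ext (dual G) k) (X : ext G k),
        pairing (laplacian_dual mu gamma A) X = pairing A (laplacian mu gamma X)
    & derivation0 (laplacian_dual mu gamma)] /\
  (forall (k : nat) (X : ext G k.+1),
     laplacian mu gamma (bd_mu mu X) = bd_mu mu (laplacian mu gamma X)) /\
  (forall (k : nat) (A : ext (dual G) k),
     laplacian_dual mu gamma (d_mu mu A) = d_mu mu (laplacian_dual mu gamma A)).
Proof.
have [mJ gC _ _] := HG.
split; [split; [split|move=> k A X|split] | split].
- by move=> k; have := @lap_linear _ _ mu gamma k; rewrite /lap; case: seal.
- move=> p q A B; rewrite -!eprodE -!lapE.
  apply: (leibniz_derivation0 (@lap_linear _ _ mu gamma)) => [X|k v X].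
    exact: lap0.
  exact: lap_lmul.
- by rewrite -lapE -ldualE pairing_ldual.
- by move=> k; have := @ldual_linear _ _ mu gamma k; rewrite /ldual; case: seal.
- move=> p q A B; rewrite -!eprodE -!ldualE.
  apply: (leibniz_derivation0 (@ldual_linear _ _ mu gamma)) => [X|k xi X].
    exact: ldual_ext0.
  exact: ldual_lmul.
- by move=> k X; rewrite /bd_mu -!bdE -!lapE lap_bd.
move=> k A; rewrite -!dmuE -!ldualE; apply: pairing_injl => X.
by rewrite pairing_ldual !pairing_dmu pairing_ldual lap_bd.
Qed.
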